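(* Let $G$ be a countable amenable group. Then the set of actions of $G$ on $L_1[0,1]$ by lattice (positive) linear isometries that admit an equivalent $G$-invariant strictly convex norm is dense in $\mathrm{Act}^+_G(L_1[0,1])$.
   Context: $L_1[0,1]$ is the real Banach lattice of integrable functions on $[0,1]$ with Lebesgue measure. $\mathrm{LIso}(L_1[0,1])$ is the group of surjective positive linear isometries of $L_1[0,1]$ with the strong operator topology. $\mathrm{Act}^+_G(L_1[0,1])$ is the set of group homomorphisms $G\to\mathrm{LIso}(L_1[0,1])$ viewed as a closed subset of $\mathrm{LIso}(L_1[0,1])^G$ with the product topology. A discrete countable group is amenable if every action of it on a compact Hausdorff space admits an invariant Borel probability measure. A norm is $G$-invariant if each $g\in G$ acts isometrically for it; strictly convex if for $f\neq h$ of equal norm, $\|\frac{f+h}{2}\|<\|f\|$. *)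

(* Defs.v *)
From HB Require Import structures.
From mathcomp Require Import all_boot all_order all_algebra.
From mathcomp Require Import all_classical all_reals all_analysis.
Set Implicit Arguments. Unset Strict Implicit. Unset Printing Implicit Defensive.
Import Order.TTheory GRing.Theory Num.Theory.
Import numFieldNormedType.Exports.
Local Open Scope classical_set_scope.
Local Open Scope ring_scope.

Definition countable_group (G : groupType) : Prop :=
  exists f : G -> nat, injective f.

(* Amenability, as in the paper: every action of G (by homeomorphisms) on a
   (nonempty) compact Hausdorff space admits an invariant Borel probability
   measure.  Borel = sigma-algebra generated by the open sets. *)
Definition amenable (R : realType) (G : groupType) : Prop :=
  forall (X : ptopologicalType) (alpha : G -> X -> X),
    compact [set: X] -> hausdorff_space X ->
    (forall g, continuous (alpha g)) ->
    (forall x, alpha monoid.one x = x) ->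
    (forall g h x, alpha (monoid.mul g h) x = alpha g (alpha h x)) ->
    exists P : probability (g_sigma_algebraType (@open X)) R,
      forall g (A : set (g_sigma_algebraType (@open X))),
        measurable A -> P (alpha g @^-1` A) = P A.

(* L_1[0,1] with Lebesgue measure, represented by functions R -> R
   (representatives), with equality almost everywhere on [0,1].        *)
Section L1.
Variable R : realType.
Local Notation leb := (@lebesgue_measure R).
Local Notation I01 := (`[(0:R), (1:R)]%classic : set R).

Definition L1 (f : R -> R) : Prop := leb.-integrable I01 (EFin \o f).

Definition norm1 (f : R -> R) : R :=
  fine (\int[leb]_(x in I01) (`|f x|)%:E)%E.

Definition aeq (f g : R -> R) : Prop :=
  {ae leb, forall x, I01 x -> f x = g x}.

Definition ae_nonneg (f : R -> R) : Prop :=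
  {ae leb, forall x, I01 x -> 0 <= f x}.

(* an operator, given by its action on representatives *)
Definition Op := (R -> R) -> (R -> R).

Definition is_LIso (T : Op) : Prop :=
  [/\ (forall f, L1 f -> L1 (T f)),
      (forall f g, L1 f -> L1 g -> aeq f g -> aeq (T f) (T g)),
      (forall (a b : R) f g, L1 f -> L1 g ->
          aeq (T (fun x => a * f x + b * g x))
              (fun x => a * T f x + b * T g x)),
      (forall f, L1 f -> ae_nonneg f -> ae_nonneg (T f))
    & (forall f, L1 f -> norm1 (T f) = norm1 f)] /\
    (forall h, L1 h -> exists f, L1 f /\ aeq (T f) h).

Definition is_action (G : groupType) (rho : G -> Op) : Prop :=
  [/\ (forall g, is_LIso (rho g)),
      (forall f, L1 f -> aeq (rho monoid.one f) f)
    & (forall g h f, L1 f ->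
          aeq (rho (monoid.mul g h) f) (rho g (rho h f)))].

Definition equiv_norm (N : (R -> R) -> R) : Prop :=
  [/\ (forall f g, L1 f -> L1 g -> aeq f g -> N f = N g),
      (forall f g, L1 f -> L1 g -> N (fun x => f x + g x) <= N f + N g),
      (forall (a : R) f, L1 f -> N (fun x => a * f x) = `|a| * N f)
    & exists c C : R, [/\ 0 < c, 0 < C &
         forall f, L1 f -> c * norm1 f <= N f /\ N f <= C * norm1 f]].

Definition invariant_norm (G : groupType) (rho : G -> Op)
    (N : (R -> R) -> R) : Prop :=
  forall g f, L1 f -> N (rho g f) = N f.

Definition strictly_convex (N : (R -> R) -> R) : Prop :=
  forall f h, L1 f -> L1 h -> ~ aeq f h -> N f = N h ->
    N (fun x => (f x + h x) / 2) < N f.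

Definition admits_inv_sc_norm (G : groupType) (rho : G -> Op) : Prop :=
  exists N : (R -> R) -> R,
    [/\ equiv_norm N, invariant_norm rho N & strictly_convex N].

End L1.

(* Main.v *)
Require Import Defs.
From HB Require Import structures.
From mathcomp Require Import all_boot all_order all_algebra.
From mathcomp Require Import all_classical all_reals all_analysis.
From mathcomp Require Import measurable_realfun.
From mathcomp Require Import ring lra.
Import Order.TTheory GRing.Theory Num.Theory.
Import numFieldNormedType.Exports.
Local Open Scope classical_set_scope.
Local Open Scope ring_scope.

Set Implicit Arguments.
Unset Strict Implicit.
Unset Printing Implicit Defensive.

(** Let [l1(G; L1)] carry the action [(g F)(h) = rho_g (F (g^-1 h))]. It is
    conjugate to the left translation [F |-> F (g^-1 .)] by
    [F |-> (rho_(h^-1) (F h))_h], and translation preserves the norm whose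
    square is [|F|_1^2 + sum_h q(F h)] for any positive definite quadratic form
    [q] on [L1]; such a norm is strictly convex by the parallelogram identity.

    If [p > 0] is a probability on [G], the map [f |-> p (x) f] into
    [l1(G; L1)] is almost equivariant when [p] is almost invariant, and it is
    approximated in the strong topology by surjective lattice isometries [D]:
    cut [0,1] into small cells, cut each cell in the proportions [p h], and
    stretch the [h]-th pieces back onto the cells. Conjugating the action on
    [l1(G; L1)] back by [D] gives an action close to [rho] with an invariant
    strictly convex norm.

    Almost invariant probabilities exist by amenability: otherwise Hahn-Banach
    separates the set of all [(g p - p)_g] from 0, and the separating bounded
    functions form a compact [G]-space on which an invariant measure would
    integrate a positive function to 0. *)

(** * Hahn-Banach *)

(** Averaging a strictly convex norm over an infinite [G] can destroy strict convexity. The map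
    [f |-> p (x) f] is isometric but in general not onto, so nothing can be conjugated by it; [D]
    has to resemble it only at the finitely many functions [f] and [rho_g f] that a basic
    neighbourhood involves. A coordinate with [p h = 0] would receive nothing from [D], so
    surjectivity forces [p > 0], and this is gained by mixing in a small multiple of a positive
    probability. Squared primitives at the rationals, with summable weights, provide [q]. Elements
    of L1 are represented by functions, hence the conjugated operators are picked by choice and
    their identities hold up to null sets. *)

Section hahn_banach.
Variables (R : realType) (V : lmodType R).
Implicit Types (p q : V -> R) (x y c : V).

Definition sublinear p :=
  (forall x y, p (x + y) <= p x + p y) /\
  (forall (a : R) x, 0 <= a -> p (a *: x) = a * p x).

Lemma sublinear0 p : sublinear p -> p 0 = 0.
Proof. by move=> [_ hp]; rewrite -(scale0r 0) hp// mul0r. Qed.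

Lemma sublinear_oppr_ge p x : sublinear p -> - p (- x) <= p x.
Proof.
move=> sp; rewrite -subr_ge0 opprK -(sublinear0 sp) -(subrr x).
exact: sp.1.
Qed.

(* The witness is [x |-> inf_(t >= 0, c in C) p (x + t c) - t e]. *)
Lemma sublinear_lower p (C : set V) (e : R) :
  sublinear p -> C !=set0 ->
  (forall c c' (a : R), C c -> C c' -> 0 <= a <= 1 ->
    C (a *: c + (1 - a) *: c')) ->
  (forall c, C c -> e <= p c) ->
  exists q, [/\ sublinear q, (forall x, q x <= p x) &
    forall c, C c -> q (- c) <= - e].
Proof.
move=> sp [c0 Cc0] convC Ce.
pose A x := [set r | exists (t : R) c, [/\ 0 <= t, C c & r = p (x + t *: c) - t * e]].
pose q x := inf (A x).
(* Bounded below, since [t e <= t p c = p (t c) <= p (x + t c) + p (- x)]. *)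
have Alb x r : A x r -> - p (- x) <= r.
  move=> [t [c [t0 Cc ->]]].
  have := sp.1 (x + t *: c) (- x); rewrite addrAC subrr add0r sp.2//.
  have := ler_wpM2l t0 (Ce _ Cc); lra.
have hA x : has_inf (A x).
  split; last by exists (- p (- x)) => r /Alb.
  by exists (p (x + 0 *: c0) - 0 * e), 0, c0.
have qle x (t : R) c : 0 <= t -> C c -> q x <= p (x + t *: c) - t * e.
  by move=> t0 Cc; apply: ge_inf; [exact: (hA x).2|exists t, c].
have le_q x r : (forall (t : R) c, 0 <= t -> C c -> r <= p (x + t *: c) - t * e) ->
    r <= q x.
  move=> h; apply: lb_le_inf; first exact: (hA x).1.
  by move=> _ [t [c [t0 Cc ->]]]; exact: h.
(* One inequality suffices: at [a^-1] and [a *: x] it gives the reverse one. *)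
have qhom (a : R) x : 0 < a -> a * q x <= q (a *: x).
  move=> a0; apply: (le_q _) => t c t0 Cc.
  have -> : a *: x + t *: c = a *: (x + (t / a) *: c).
    by rewrite scalerDr scalerA mulrCA divff ?mulr1// gt_eqF.
  have -> : t * e = a * (t / a * e).
    by rewrite mulrA [a * (_ / _)]mulrC divfK// gt_eqF.
  rewrite sp.2; last exact: ltW.
  by rewrite -mulrBr ler_pM2l// qle// divr_ge0// ltW.
exists q; split.
- split=> [x y|a x].
    rewrite -lerBlDr; apply: (le_q _) => t c t0 Cc.
    rewrite lerBlDr [leRHS]addrC -lerBlDr; apply: (le_q _) => t' c' t'0 Cc'.
    rewrite lerBlDr.
    have [s0|s0] := eqVneq (t + t') 0.
      have [-> ->] : t = 0 /\ t' = 0 by split; lra.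
      apply: le_trans (qle (x + y) 0 c0 _ _) _ => //.
      have := sp.1 x y; rewrite !scale0r !addr0; lra.
    have sp0 : 0 < t + t' by rewrite lt0r s0 addr_ge0.
    (* By convexity [t c + t' c'] is [t + t'] times a point of [C]. *)
    apply: le_trans (qle (x + y) (t + t')
      ((t / (t + t')) *: c + (1 - t / (t + t')) *: c') _ _) _.
    + exact: ltW.
    + by apply: convC => //; rewrite divr_ge0 ?(ltW sp0)//= ler_pdivrMr// mul1r lerDl.
    have -> : x + y + (t + t') *: ((t / (t + t')) *: c + (1 - t / (t + t')) *: c')
        = (x + t *: c) + (y + t' *: c').
      rewrite scalerDr !scalerA mulrBr mulr1 mulrCA divff// mulr1.
      by rewrite [t + t']addrC addrK addrACA.
    have := sp.1 (x + t *: c) (y + t' *: c'); lra.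
  rewrite le_eqVlt => /predU1P[<-|a0].
    rewrite scale0r mul0r; apply/eqP; rewrite eq_le; apply/andP; split.
      apply: le_trans (qle 0 0 c0 _ _) _ => //.
      by rewrite scale0r mul0r addr0 subr0 sublinear0.
    apply: (le_q _) => t c t0 Cc; rewrite add0r sp.2// -mulrBr mulr_ge0//.
    by rewrite subr_ge0 Ce.
  apply/eqP; rewrite eq_le qhom// andbT.
  have := qhom a^-1 (a *: x); rewrite invr_gt0 a0 => /(_ isT).
  by rewrite scalerA mulVf ?gt_eqF// scale1r mulrC ler_pdivrMr// [_ * a]mulrC.
- by move=> x; apply: le_trans (qle x 0 c0 _ _) _ => //; rewrite scale0r mul0r addr0 subr0.
- move=> c Cc; apply: le_trans (qle (- c) 1 c _ _) _ => //.
  by rewrite scale1r mul1r addNr sublinear0// sub0r.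
Qed.

(* A sublinear functional minimal below [q] is linear, since otherwise
   [sublinear_lower] with [C = {x}] and [e = p x] would lower it further. *)
Lemma hahn_banach q : sublinear q ->
  exists l : V -> R, [/\ forall x y, l (x + y) = l x + l y,
    forall a x, l (a *: x) = a * l x & forall x, l x <= q x].
Proof.
move=> sq.
pose T := {p : V -> R | sublinear p /\ forall x, p x <= q x}.
(* The order is reversed, so that the maximal elements of Zorn's lemma are the minimal
   functionals. *)
pose le (p p' : T) := `[< forall x, sval p' x <= sval p x >].
have [p|p1 p2 p3|p1 p2|A totA|p minp] := @Zorn T le.
- by apply/asboolP.
- by move=> /asboolP h1 /asboolP h2; apply/asboolP => x; exact: le_trans (h1 x).
- move=> /asboolP h1 /asboolP h2; case: p1 p2 h1 h2 => [p1 P1] [p2 P2] /= h1 h2.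
  apply: eq_sig_hprop => [p|]; first exact: Prop_irrelevance.
  apply/funext => x /=.
  by apply/eqP; rewrite eq_le h1 h2.
- have [[p0 Ap0]|A0] := pselect (A !=set0); last first.
    exists (exist _ q (conj sq (fun x => lexx _))) => s As.
    by exfalso; apply: A0; exists s.
  pose B x := [set sval p x | p in A].
  have hB x : has_inf (B x).
    split; first by exists (sval p0 x), p0.
    exists (- q (- x)) => _ [p Ap <-].
    apply: le_trans (sublinear_oppr_ge _ (svalP p).1).
    by rewrite lerN2; exact: (svalP p).2.
  have infB x (p : T) : A p -> inf (B x) <= sval p x.
    by move=> Ap; apply: ge_inf; [exact: (hB x).2|exists p].
  have ler_infB x r : (forall p : T, A p -> r <= sval p x) -> r <= inf (B x).
    by move=> h; apply: lb_le_inf; [exact: (hB x).1|move=> _ [p Ap <-]; exact: h].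
  have si : sublinear (fun x => inf (B x)).
    split=> [x y|a x a0].
      rewrite -lerBlDr; apply: (ler_infB _) => p Ap.
      rewrite lerBlDr [leRHS]addrC -lerBlDr; apply: (ler_infB _) => p' Ap'.
      rewrite lerBlDr.
      (* In a chain the smaller of the two functionals serves at both arguments. *)
      wlog ple : p p' x y Ap Ap' / le p p'.
        move=> w; have [h|h] := totA _ _ Ap Ap'; first exact: w.
        by rewrite addrC [leRHS]addrC; exact: w.
      apply: le_trans (infB _ _ Ap') _; apply: le_trans ((svalP p').1.1 _ _) _.
      by rewrite addrC lerD2l; move/asboolP: ple; exact.
    have inf_hom (b : R) z : 0 < b -> b * inf (B z) <= inf (B (b *: z)).
      move=> b0; apply: (ler_infB _) => p Ap; rewrite (svalP p).1.2; last exact: ltW.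
      by rewrite ler_pM2l// infB.
    move: a0; rewrite le_eqVlt => /predU1P[<-|a0].
      rewrite scale0r mul0r; apply/eqP; rewrite eq_le; apply/andP; split.
        by rewrite (le_trans (infB _ _ Ap0))// sublinear0//; exact: (svalP p0).1.
      by apply: (ler_infB _) => p Ap; rewrite sublinear0//; exact: (svalP p).1.
    apply/eqP; rewrite eq_le inf_hom// andbT.
    have := inf_hom a^-1 (a *: x); rewrite invr_gt0 a0 => /(_ isT).
    by rewrite scalerA mulVf ?gt_eqF// scale1r mulrC ler_pdivrMr// [_ * a]mulrC.
  have iq x : inf (B x) <= q x.
    by apply: le_trans (infB _ _ Ap0) _; exact: (svalP p0).2.
  exists (exist _ (fun x => inf (B x)) (conj si iq)) => s As; apply/asboolP => x /=.
  exact: infB.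
have [sp pq] := svalP p.
have pN x : sval p (- x) = - sval p x.
  apply/eqP; rewrite eq_le; apply/andP; split; last first.
    by rewrite lerNl; exact: sublinear_oppr_ge.
  have [||c c' a -> ->|c ->|p' [sp' lep' p'x]] :=
      @sublinear_lower (sval p) [set x] (sval p x) => //.
  - by exists x.
  - by move=> _ /=; rewrite -scalerDl addrC subrK scale1r.
  have sp'q z : p' z <= q z by exact: le_trans (pq z).
  have := minp (exist _ p' (conj sp' sp'q)); rewrite /le/=.
  have -> : `[< forall z, p' z <= sval p z >] = true by apply/asboolP.
  move=> /(_ isT)/(congr1 sval)/= p'p; apply: le_trans (p'x x erefl).
  by rewrite p'p.
exists (sval p); split => // [x y|a x].
- apply/eqP; rewrite eq_le sp.1/=.
  by have := sp.1 (- x) (- y); rewrite -opprD !pN; lra.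
- have [a0|a0] := leP 0 a; first exact: sp.2.
  rewrite -[a in LHS]opprK scaleNr pN sp.2; last by rewrite oppr_ge0 ltW.
  by rewrite mulNr opprK.
Qed.

(** Once [n] is lowered by [sublinear_lower], every linear minorant [l] has [l (- c) <= - e], which
    by linearity is the separation. *)
Lemma hahn_banach_separation (n : V -> R) (C : set V) (e : R) :
  sublinear n -> C !=set0 ->
  (forall c c' (a : R), C c -> C c' -> 0 <= a <= 1 ->
    C (a *: c + (1 - a) *: c')) ->
  (forall c, C c -> e <= n c) ->
  exists l : V -> R, [/\ forall x y, l (x + y) = l x + l y,
    forall a x, l (a *: x) = a * l x, forall x, l x <= n x &
    forall c, C c -> e <= l c].
Proof.
move=> sn C0 convC Ce; have [q [sq qn qC]] := sublinear_lower sn C0 convC Ce.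
have [l [lD lZ lq]] := hahn_banach sq; exists l; split => // [x|c Cc].
  exact: le_trans (qn x).
have := le_trans (lq (- c)) (qC _ Cc).
by rewrite -scaleN1r lZ mulN1r lerN2.
Qed.

End hahn_banach.

(** * The space l1 over a discrete index set *)

Section ell1.
Variables (R : realType) (T : choiceType).
Implicit Types x y : T -> R.

Definition ell1_norm x : \bar R := \esum_(t in [set: T]) (`|x t|%:E).

Lemma ell1_norm_ge0 x : (0 <= ell1_norm x)%E.
Proof. by apply: esum_ge0 => t _; rewrite lee_fin. Qed.

Lemma ell1_normD x y : (ell1_norm (x + y)%R <= ell1_norm x + ell1_norm y)%E.
Proof.
rewrite /ell1_norm -esumD; [|by move=> *; rewrite lee_fin..].
by apply: le_esum => t _; rewrite -EFinD lee_fin ler_normD.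
Qed.

(** The inequality [<=] passes from finite subsums to the supremum; for [a > 0] the same inequality
    with [a^-1] gives the other half. *)
Lemma esumZl (a : R) (u : T -> \bar R) : 0 <= a -> (forall t, 0 <= u t)%E ->
  (\esum_(t in [set: T]) (a%:E * u t) = a%:E * \esum_(t in [set: T]) u t)%E.
Proof.
have le (b : R) (v : T -> \bar R) : 0 <= b -> (forall t, 0 <= v t)%E ->
    (\esum_(t in [set: T]) (b%:E * v t) <= b%:E * \esum_(t in [set: T]) v t)%E.
  move=> b0 v0; apply: ge_ereal_sup => _ [X [finX _] <-].
  rewrite fsbig_finite// -ge0_sume_distrr// lee_wpmul2l ?lee_fin//.
  by apply: esum_ge; exists X => //; rewrite fsbig_finite.
rewrite le_eqVlt => /predU1P[<- u0|a0 u0].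
  by rewrite mul0e esum1// => t _; rewrite mul0e.
apply/eqP; rewrite eq_le le ?(ltW a0)//=.
rewrite -lee_pdivlMl//.
apply: le_trans (le a^-1 _ _ _); first 1 last.
- by rewrite invr_ge0 ltW.
- by move=> t; rewrite mule_ge0// lee_fin ltW.
apply: le_esum => t _; rewrite muleA -EFinM mulVf ?mul1e//.
by rewrite gt_eqF.
Qed.

Lemma ell1_normZ a x : ell1_norm (a *: x)%R = (`|a|%:E * ell1_norm x)%E.
Proof.
rewrite /ell1_norm -esumZl//; apply: eq_esum => t _.
by rewrite -EFinM -normrM.
Qed.

Definition ell1_pred : {pred T -> R} := fun x => `[< (ell1_norm x < +oo)%E >].

Lemma ell1_submod : submod_closed ell1_pred.
Proof.
split=> [|a x y /asboolP xf /asboolP yf].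
  by apply/asboolP; rewrite /ell1_norm esum1 ?ltry// => t _; rewrite normr0.
apply/asboolP; apply: le_lt_trans (ell1_normD _ _) _.
by rewrite ell1_normZ lte_add_pinfty// lte_mul_pinfty// lee_fin.
Qed.

HB.instance Definition _ := GRing.isSubmodClosed.Build R (T -> R) ell1_pred ell1_submod.

(** Packaged as a submodule because the Hahn-Banach lemmas are stated over an [lmodType]. *)
Record ell1 := Ell1 { ell1_val :> T -> R; _ : ell1_val \in ell1_pred }.
HB.instance Definition _ := [isSub for ell1_val].
HB.instance Definition _ := [Choice of ell1 by <:].
HB.instance Definition _ := [SubChoice_isSubLmodule of ell1 by <:].

Definition nrm1 (x : ell1) : R := fine (ell1_norm x).

Lemma nrm1E (x : ell1) : ((nrm1 x)%:E = ell1_norm x)%E.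
Proof.
rewrite /nrm1 fineK// ge0_fin_numE ?ell1_norm_ge0//.
by case: x => x /= xf; exact/asboolP.
Qed.

Lemma nrm1_sublinear : sublinear nrm1.
Proof.
split=> [x y|a x a0]; first by rewrite -lee_fin EFinD !nrm1E ell1_normD.
by apply: EFin_inj; rewrite EFinM !nrm1E ell1_normZ ger0_norm.
Qed.

End ell1.

(** * Almost invariant probabilities *)

Section reiter_dual.
Variables (R : realType) (G : groupType).
Local Notation ell1G := (ell1 R G).

Definition prob_fun (p : G -> R) :=
  (forall h, 0 <= p h) /\ \esum_(h in [set: G]) (p h)%:E = 1%E.

Lemma bij_mulg (g : G) : set_bij [set: G] [set: G] (monoid.mul g).
Proof.
split=> //= [h k _ _|h _]; first exact: mulgI.
by exists (g^-1 * h)%g => //; rewrite mulVKg.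
Qed.

Lemma ell1_norm_shift (g : G) (x : G -> R) :
  ell1_norm (fun h => x (g * h)%g) = ell1_norm x.
Proof. by rewrite /ell1_norm [RHS](reindex_esum _ _ _ _ (bij_mulg g)). Qed.

Lemma ell1_shift_subproof (g : G) (x : ell1G) :
  (fun h => x (g^-1 * h)%g) \in @ell1_pred R G.
Proof. by apply/asboolP; rewrite ell1_norm_shift -nrm1E ltry. Qed.

Definition ell1_shift g x : ell1G := Ell1 (ell1_shift_subproof g x).

Lemma prob_fun_delta (k : G) : prob_fun (fun h => (h == k)%:R).
Proof.
split=> [h|]; first by case: eqP.
rewrite (_ : (fun h => _) = fun h => if h \in [set k] then 1%E else 0%E).
  by rewrite -esum_mkcond esum_set1.
by apply/funext => h; rewrite in_set1; case: eqP.
Qed.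

Lemma prob_fun_ell1 p : prob_fun p -> p \in @ell1_pred R G.
Proof.
move=> [p0 p1]; apply/asboolP; rewrite /ell1_norm.
by under eq_esum do rewrite ger0_norm//; rewrite p1 ltry.
Qed.

Definition delta (k : G) : ell1G := Ell1 (prob_fun_ell1 (prob_fun_delta k)).

Lemma nrm1_delta k : nrm1 (delta k) = 1.
Proof.
apply: EFin_inj; rewrite nrm1E /ell1_norm -(prob_fun_delta k).2.
by apply: eq_esum => h _; rewrite ger0_norm//=; case: eqP.
Qed.

Lemma ell1_shift_delta g k : ell1_shift g (delta k) = delta (g * k)%g.
Proof.
apply: val_inj; apply/funext => h /=; congr (nat_of_bool _)%:R.
by apply/eqP/eqP => [<-|->]; rewrite ?mulVKg ?mulKg.
Qed.

(* If no probability is almost invariant, the convex set of all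
   [(g.p - p)_(g in s)] stays away from 0 in a finite power of l1, and a
   separating functional is given by bounded functions. *)
Lemma not_reiter_dual (s : seq G) (e : R) :
  (forall p, prob_fun p -> exists2 g, g \in s &
    (e%:E < ell1_norm (fun h => p (g^-1 * h)%g - p h)%R)%E) ->
  exists u : G * G -> R, (forall t, `|u t| <= (size s)%:R) /\
    forall k, e <= \sum_(g <- undup s) (u (g, g * k)%g - u (g, k)).
Proof.
move=> nreiter.
pose V := G -> ell1G.
(* A seminorm on families over all of [G] that sees only the indices in [s]; it plays the norm of a
   finite power of l1. *)
pose n (x : V) := \sum_(g <- undup s) nrm1 (x g).
have sn : sublinear n.
  split=> [x y|a x a0].
    by rewrite /n -big_split/= ler_sum// => g _; exact: (nrm1_sublinear _ _).1.
  by rewrite /n mulr_sumr; apply: eq_bigr => g _; exact: (nrm1_sublinear _ _).2.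
pose d (x : ell1G) : V := fun g => ell1_shift g x - x.
pose C := [set d x | x in [set x : ell1G | prob_fun x]].
have C0 : C !=set0.
  by exists (d (delta 1%g)), (delta 1%g) => //; exact: prob_fun_delta.
have convC c c' (a : R) : C c -> C c' -> 0 <= a <= 1 ->
    C (a *: c + (1 - a) *: c').
  move=> [x [x0 x1] <-] [y [y0 y1] <-] /andP[a0 a1].
  exists (a *: x + (1 - a) *: y).
    split=> [h|] /=.
      by rewrite addr_ge0// mulr_ge0// subr_ge0.
    under eq_esum do rewrite EFinD EFinM (EFinM (1 - a)).
    rewrite esumD; last 2 first.
    - by move=> h _; rewrite mule_ge0 ?lee_fin.
    - by move=> h _; rewrite mule_ge0 ?lee_fin ?subr_ge0.
    rewrite !esumZl ?subr_ge0//; [|by move=> h; rewrite lee_fin..].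
    by rewrite x1 y1 !mule1 -EFinD addrC subrK.
  apply/funext => g; apply: val_inj; apply/funext => h /=.
  rewrite /GRing.scale/= !fctE/=; ring.
have Ce c : C c -> e <= n c.
  move=> [x px <-]; have [g gs eg] := nreiter _ px.
  rewrite -lee_fin; apply: le_trans (ltW eg) _.
  rewrite -[ell1_norm _](nrm1E (d x g)) lee_fin /n.
  rewrite (bigD1_seq g) ?mem_undup ?undup_uniq//= lerDl sumr_ge0// => k _.
  by rewrite fine_ge0// ell1_norm_ge0.
have [l [lD lZ ln lC]] := hahn_banach_separation sn C0 convC Ce.
have l0 : l 0 = 0 by rewrite -(scale0r 0) lZ mul0r.
have lN x : l (- x) = - l x by rewrite -scaleN1r lZ mulN1r.
pose iota (g : G) (x : ell1G) : V := fun g' => if g' == g then x else 0.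
exists (fun t => l (iota t.1 (delta t.2))); split=> [[g k]/=|k].
  (* At most one summand is nonzero, but the cruder bound by the length of [s] is all that
     compactness will need. *)
  have nle x : x = delta k \/ x = - delta k -> n (iota g x) <= (size s)%:R.
    move=> xE; apply: (@le_trans _ _ (\sum_(g <- undup s) 1)).
      rewrite ler_sum// => g' _; rewrite /iota; case: ifP => _.
        case: xE => ->; first by rewrite nrm1_delta.
        rewrite -(nrm1_delta k) -lee_fin !nrm1E le_eqVlt; apply/orP; left.
        by apply/eqP; apply: eq_esum => h _; rewrite normrN.
      by rewrite (sublinear0 (nrm1_sublinear _ _)).
    by rewrite big_const_seq count_predT iter_addr_0 ler_nat size_undup.
  rewrite ler_norml lerNl -lN; apply/andP; split.
    apply: le_trans (ln _) _.
    have -> : - iota g (delta k) = iota g (- delta k); last by apply: nle; right.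
    by apply/funext => g'; rewrite /iota !fctE; case: ifP => // _; rewrite oppr0.
  by apply: le_trans (ln _) _; apply: nle; left.
have /lC : C (d (delta k)) by exists (delta k) => //; exact: prob_fun_delta.
move=> /le_trans; apply.
(* The part of [d (delta k)] on the indices in [s]. The difference of the two lives outside [s],
   where [n] does not see it, so [l <= n] compares their values. *)
pose y : V := \sum_(g <- undup s) (iota g (delta (g * k)%g) - iota g (delta k)).
have -> : \sum_(g <- undup s) (l (iota (g, g * k)%g.1 (delta (g, g * k)%g.2)) - l (iota (g, k).1 (delta (g, k).2))) = l y.
  rewrite /y; elim: (undup s) => [|g r ih]; first by rewrite !big_nil.
  by rewrite !big_cons lD ih lD lN.
rewrite -subr_le0 -lN -lD; apply: le_trans (ln _) _.
rewrite /n big_seq big1// => g gs.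
rewrite !fctE (_ : y g = d (delta k) g) ?subrr ?(sublinear0 (nrm1_sublinear _ _))//.
rewrite /y fct_sumE (bigD1_seq g) ?undup_uniq//= big1 ?addr0.
  by rewrite /iota /d !fctE eqxx ell1_shift_delta.
by move=> g' g'g; rewrite /iota !fctE eq_sym (negPf g'g) subrr.
Qed.

End reiter_dual.

(** * Topology of subspaces and products *)

Section subtype_compact.
Variables (X : topologicalType) (A : set X).

Lemma compact_set_type : compact A -> compact [set: set_type A].
Proof.
move=> cA F FF _.
have FvA : (set_val @ F) A.
  rewrite /fmap/=; apply: filterS (@filterT _ F _) => x _ /=; exact: set_valP.
have [x [Ax clx]] := cA (set_val @ F) _ FvA.
exists (exist _ x (mem_set Ax)); split=> // B C FB.
move=> [_ [[W oW <-]] /= Wx WC].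
have [z [Bz Wz]] := clx (set_val @` B) W
  (filterS (@preimage_image _ _ set_val B) FB) (open_nbhs_nbhs (conj oW Wx)).
case: Bz Wz => y By <- Wy; exists y; split=> //; exact: WC.
Qed.

Lemma hausdorff_set_type : hausdorff_space X -> hausdorff_space (set_type A).
Proof.
move=> hX x y clxy; apply: val_inj; apply: hX => B C Bx Cy.
have [z [Bz Cz]] := clxy (set_val @^-1` B) (set_val @^-1` C)
  (initial_continuous Bx) (initial_continuous Cy).
by exists (set_val z).
Qed.

End subtype_compact.

Lemma continuous_prod_topology (I : Type) (K : I -> topologicalType)
    (W : topologicalType) (f : W -> prod_topology K) :
  (forall i, continuous (fun w => f w i)) -> continuous f.
Proof.
move=> fc w; apply/cvg_sup => i A [_ [[B oB <-]] /= Bfw BA].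
have := fc i w B (open_nbhs_nbhs (conj oB Bfw)).
by apply: (@filterS _ (nbhs w)) => z /= Bz; exact: BA.
Qed.

(** * Almost invariant probabilities from amenability *)

Section amenable_reiter.
Variables (R : realType) (G : groupType).

(** Continuous functions are Borel, bounded ones are integrable for a probability, and invariance
    says that the image of [P] under [alpha g] is [P]. *)
Lemma amenable_invariant_integral (X : ptopologicalType) (alpha : G -> X -> X)
    (P : probability (g_sigma_algebraType (@open X)) R) (f : X -> R) (M : R) :
  (forall g, continuous (alpha g)) ->
  (forall g (A : set (g_sigma_algebraType (@open X))),
        measurable A -> P (alpha g @^-1` A) = P A) ->
  continuous f -> (forall x, `|f x| <= M) ->
  P.-integrable setT (EFin \o f) /\
  forall g, (\int[P]_x (f (alpha g x))%:E = \int[P]_x (f x)%:E)%E.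
Proof.
move=> calpha Pinv cf fM.
pose Y := g_sigma_algebraType (@open X).
have mf (h : X -> R) : continuous h -> measurable_fun setT (h : Y -> R).
  move=> /continuousP ch.
  apply: (measurability _ (RGenOpens.measurableE R)).
  move=> _ [_ [a [b ->]] <-]; rewrite setTI; apply: sub_sigma_algebra.
  by apply: ch; exact: interval_open.
have ifn (h : X -> R) : continuous h -> (forall x, `|h x| <= M) ->
    P.-integrable setT (EFin \o h : Y -> \bar R).
  move=> ch hM; apply: (@le_integrable _ _ _ P setT measurableT _ (cst M%:E)) => //.
  - by apply/measurable_EFinP; exact: (mf h ch).
  - by move=> x _ /=; rewrite lee_fin (le_trans (hM x))// ler_norm.
  - by apply: finite_measure_integrable_cst.
split=> [|g]; first exact: ifn.
have malpha : measurable_fun setT (alpha g : Y -> Y).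
  apply: (@measurability _ _ Y Y setT (alpha g) (@open X)) => // _ [B oB <-].
  rewrite setTI; apply: sub_sigma_algebra; move: B oB; apply/continuousP.
  exact: calpha.
have mF : measurable_fun setT (EFin \o f : Y -> \bar R).
  by apply/measurable_EFinP; exact: (mf f cf).
have iF : P.-integrable (alpha g @^-1` setT) ((EFin \o f) \o alpha g : Y -> \bar R).
  rewrite preimage_setT; apply: (ifn (f \o alpha g)) => x; last exact: fM.
  by apply: continuous_comp; [exact: calpha|exact: cf].
have := @integral_pushforward _ _ Y Y R (alpha g) malpha P setT _ mF iF measurableT.
rewrite preimage_setT => <-.
by apply: eq_measure_integral => A mA _; exact: Pinv.
Qed.

Lemma amenable_reiter (s : seq G) (e : R) : amenable R G -> 0 < e ->
  exists2 p : G -> R, prob_fun p & forall g, g \in s ->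
    (ell1_norm (fun h => p (g^-1 * h)%g - p h)%R <= e%:E)%E.
Proof.
move=> amG e0; apply: contrapT => nR.
have [p pp|u [uM ue]] := @not_reiter_dual R G s e.
  apply: contrapT => np; apply: nR; exists p => // g gs.
  by rewrite leNgt; apply/negP => lt; apply: np; exists g.
pose Z := prod_topology (fun _ : G * G => R).
pose M : R := (size s)%:R.
pose v (k : G) (x : Z) := \sum_(g <- undup s) (x (g, g * k)%g - x (g, k)).
pose K : set Z := [set x | forall t, `[- M, M]%classic (x t)] `&`
  \bigcap_(k in [set: G]) (v k @^-1` [set r | e <= r]).
have pc t : continuous (fun x : Z => x t).
  exact: (@proj_continuous _ (fun=> R : topologicalType) t).
have cB (W : topologicalType) (a b : W -> R) : continuous a -> continuous b ->
    continuous (fun w => a w - b w).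
  by move=> ca cb w; exact: cvgB (ca w) (cb w).
have cK : compact K.
  apply: compact_closedI.
    apply: (@tychonoff _ (fun=> R : topologicalType) (fun=> `[- M, M]%classic)).
    by move=> t; exact: segment_compact.
  apply: closed_bigI => k _; apply: preimage_closed; last exact: closed_ge.
  move=> x _; apply: continuous_big => [|g _]; first exact: add_continuous.
  exact: (cB Z (fun y => y (g, g * k)%g) (fun y => y (g, k))).
have Ku : K u by split=> [t|k _]; [rewrite /= in_itv/= -ler_norml|exact: ue].
pose x0 : set_type K := exist _ (u : Z) (mem_set Ku).
pose X : ptopologicalType := HB.pack (set_type K) (isPointed.Build (set_type K) x0).
(* Translation on the right commutes with the left multiplication by [g] in [v]:
   [v l (sh k x) = v (l * k) x]. Hence [K] is stable, and right translation of the argument composes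
   as a left action. *)
pose sh (k : G) (x : Z) : Z := fun t => x (t.1, (t.2 * k)%g).
have Ksh k (x : Z) : K x -> K (sh k x).
  move=> [xM xe]; split=> [t|l _]; first exact: xM.
  have := xe (l * k)%g I; congr (_ <= _); apply: eq_bigr => g _.
  by rewrite /sh/= mulgA.
pose alpha (k : G) (x : X) : X :=
  exist _ (sh k (set_val (x : set_type K))) (mem_set (Ksh k _ (set_valP (x : set_type K)))).
have csh k : continuous (sh k).
  by apply: continuous_prod_topology => t; exact: pc.
have calpha k : continuous (alpha k).
  apply/continuousP => _ [B oB <-].
  exists (sh k @^-1` B) => //; move: B oB; apply/continuousP; exact: csh.
have [|||||P Pinv] := amG X alpha.
- exact: compact_set_type.
- apply: hausdorff_set_type; apply: hausdorff_product => _; exact: Rhausdorff.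
- exact: calpha.
- by move=> x; apply: val_inj; apply/funext => -[g h]; rewrite /= /sh/= mulg1.
- by move=> g h x; apply: val_inj; apply/funext => -[g' h']; rewrite /= /sh/= mulgA.
pose c (t : G * G) (x : X) : R := set_val (x : set_type K) t.
have cc t : continuous (c t).
  move=> x; apply: (@continuous_comp X Z R set_val (fun z => z t)); last exact: pc.
  exact: initial_continuous.
have cM t x : `|c t x| <= M.
  by have := (set_valP (x : set_type K)).1 t; rewrite /= in_itv/= -ler_norml.
have cI t := (amenable_invariant_integral calpha Pinv (cc t) (cM t)).1.
have cE t := (amenable_invariant_integral calpha Pinv (cc t) (cM t)).2.
(* Only the inequality at [k = 1] is integrated. The function [c (g, g)] is [c (g, 1)] composed with
   [alpha g], so each difference has integral 0. *)
have cBI (r : seq G) : P.-integrable setT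
    (fun x => (\sum_(g <- r) (c (g, g) x - c (g, 1%g) x))%:E) /\
    (\int[P]_x (\sum_(g <- r) (c (g, g) x - c (g, 1%g) x))%:E = 0)%E.
  elim: r => [|g r [ihI ihE]].
    under eq_fun do rewrite big_nil; split; first exact: integrable0.
    by rewrite integral0.
  have dI : P.-integrable setT (fun x => (c (g, g) x - c (g, 1%g) x)%:E).
    exact: (integrableB measurableT (cI (g, g)) (cI (g, 1%g))).
  under eq_fun do rewrite big_cons EFinD; split.
    exact: (integrableD measurableT dI ihI).
  rewrite (integralD measurableT dI ihI) ihE adde0.
  under eq_integral do rewrite EFinB.
  rewrite (integralB measurableT (cI (g, g)) (cI (g, 1%g)))//= -(cE (g, 1%g) g).
  have shE x : c (g, 1%g) (alpha g x) = c (g, g) x.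
    by rewrite -[LHS]/(c (g, (1 * g)%g) x) mul1g.
  under [X in (_ - X)%E]eq_integral do rewrite shE.
  by rewrite subee//; exact: (integrable_fin_num measurableT (cI (g, g))).
have : (e%:E <= 0)%E; last by rewrite lee_fin leNgt e0.
rewrite -(cBI (undup s)).2.
have <- : (\int[P]_x (cst e%:E x) = e%:E)%E.
  by rewrite integral_cst//= probability_setT mule1.
apply: le_integral => //.
- exact: finite_measure_integrable_cst.
- exact: (cBI _).1.
move=> x _ /=; rewrite lee_fin.
have := (set_valP (x : set_type K)).2 1%g I; congr (_ <= _).
by apply: eq_bigr => g _; rewrite mulg1.
Qed.


End amenable_reiter.

(** * The space L1[0,1] *)

Section L1_theory.
Variable R : realType.
Local Notation leb := (@lebesgue_measure R).
Local Notation I01 := (`[(0:R), (1:R)]%classic : set R).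
Implicit Types f g h : R -> R.

Lemma measurable_I01 : measurable (I01 : set (measurableTypeR R)).
Proof. exact: measurable_itv. Qed.
Hint Resolve measurable_I01 : core.

Lemma L1_measurable f : L1 f -> measurable_fun I01 f.
Proof. by move=> /measurable_int /measurable_EFinP. Qed.

Lemma L1_lin (a b : R) f g : L1 f -> L1 g -> L1 (fun x => a * f x + b * g x).
Proof.
move=> Lf Lg.
by have := integrableD measurable_I01 (integrableZl measurable_I01 a Lf)
  (integrableZl measurable_I01 b Lg).
Qed.

Lemma L1Z (a : R) f : L1 f -> L1 (fun x => a * f x).
Proof. by move=> Lf; have := integrableZl measurable_I01 a Lf. Qed.

Lemma L1D f g : L1 f -> L1 g -> L1 (fun x => f x + g x).
Proof. by move=> Lf Lg; have := integrableD measurable_I01 Lf Lg. Qed.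

Lemma L1B f g : L1 f -> L1 g -> L1 (fun x => f x - g x).
Proof. by move=> Lf Lg; have := integrableB measurable_I01 Lf Lg. Qed.

Lemma L1_norm f : L1 f -> L1 (fun x => `|f x|).
Proof. by move=> Lf; have := integrable_abse Lf. Qed.

Lemma L1_cst (a : R) : L1 (fun=> a).
Proof.
apply/integrableP; split; first exact: measurable_cst.
rewrite integral_cst//= lebesgue_measure_itv/= lte_fin ltr01 oppr0 adde0.
by rewrite mule1 ltry.
Qed.

Lemma L1P f : measurable_fun I01 f ->
  (\int[leb]_(x in I01) `|f x|%:E < +oo)%E -> L1 f.
Proof. by move=> mf fi; apply/integrableP; split=> //; exact/measurable_EFinP. Qed.

Lemma norm1E f : L1 f -> ((norm1 f)%:E = \int[leb]_(x in I01) `|f x|%:E)%E.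
Proof.
by move=> Lf; rewrite /norm1 fineK//; exact: integrable_fin_num (L1_norm Lf).
Qed.

Lemma norm1_ge0 f : 0 <= norm1 f.
Proof. by rewrite /norm1 fine_ge0// integral_ge0. Qed.

Lemma norm1D f g : L1 f -> L1 g -> norm1 (fun x => f x + g x) <= norm1 f + norm1 g.
Proof.
move=> Lf Lg; rewrite -lee_fin EFinD !norm1E//; last exact: L1D.
rewrite -ge0_integralD//; last 2 first.
- exact: measurable_int (L1_norm Lf).
- exact: measurable_int (L1_norm Lg).
apply: ge0_le_integral => //.
- exact: measurable_int (L1_norm (L1D Lf Lg)).
- exact: measurable_int (L1D (L1_norm Lf) (L1_norm Lg)).
- by move=> x _; rewrite -EFinD lee_fin ler_normD.
Qed.

Lemma norm1Z (a : R) f : L1 f -> norm1 (fun x => a * f x) = `|a| * norm1 f.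
Proof.
move=> Lf; apply: EFin_inj; rewrite EFinM !norm1E//; last exact: L1Z.
rewrite -ge0_integralZl//; last exact: measurable_int (L1_norm Lf).
by apply: eq_integral => x _; rewrite normrM EFinM.
Qed.

Lemma eq_norm1 f g : (forall x, f x = g x) -> norm1 f = norm1 g.
Proof. by move=> /funext ->. Qed.

Lemma norm1N f : norm1 (fun x => - f x) = norm1 f.
Proof. by congr fine; apply: eq_integral => x _; rewrite normrN. Qed.

Lemma norm1_dist f g h : L1 f -> L1 g -> L1 h ->
  norm1 (fun x => f x - h x) <=
  norm1 (fun x => f x - g x) + norm1 (fun x => g x - h x).
Proof.
move=> Lf Lg Lh; apply: le_trans (norm1D (L1B Lf Lg) (L1B Lg Lh)).
by rewrite le_eqVlt; apply/orP; left; apply/eqP/eq_norm1 => x; rewrite subrKA.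
Qed.

Lemma aeq_refl f : aeq f f.
Proof. exact: aeW. Qed.
Hint Resolve aeq_refl : core.

Global Instance ae_leb_filter : Filter (nbhs (almost_everywhere leb)) :=
  @ae_filter_ringOfSetsType _ (measurableTypeR R) R leb.

Lemma aeq_sym f g : aeq f g -> aeq g f.
Proof. by apply: filterS => x h /h. Qed.

Lemma aeq_trans g f h : aeq f g -> aeq g h -> aeq f h.
Proof. by apply: filterS2 => x h1 h2 Ix; rewrite h1// h2. Qed.

Lemma aeq_lin (a b : R) f g f' g' : aeq f f' -> aeq g g' ->
  aeq (fun x => a * f x + b * g x) (fun x => a * f' x + b * g' x).
Proof. by apply: filterS2 => x h1 h2 Ix; rewrite h1// h2. Qed.

Lemma aeqB f g f' g' : aeq f f' -> aeq g g' ->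
  aeq (fun x => f x - g x) (fun x => f' x - g' x).
Proof. by apply: filterS2 => x h1 h2 Ix; rewrite h1// h2. Qed.

Lemma aeq_norm1 f g : L1 f -> L1 g -> aeq f g -> norm1 f = norm1 g.
Proof.
move=> Lf Lg fg; congr fine; apply: ae_eq_integral => //.
- exact: measurable_int (L1_norm Lf).
- exact: measurable_int (L1_norm Lg).
- by apply: filterS fg => x h Ix; rewrite h.
Qed.

Lemma norm1_eq0 f : L1 f -> norm1 f = 0 <-> aeq f (fun=> 0).
Proof.
move=> Lf; split=> [f0|f0]; last first.
  rewrite (aeq_norm1 Lf (L1_cst 0) f0) /norm1.
  by under eq_integral do rewrite normr0; rewrite integral0.
have := norm1E Lf; rewrite f0 => /esym.
move=> /(ae_eq_integral_abs leb measurable_I01 (measurable_int leb Lf)).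
by apply: filterS => x h Ix; apply: EFin_inj; exact: h.
Qed.

Lemma aeqP f g : L1 f -> L1 g -> aeq f g <-> norm1 (fun x => f x - g x) = 0.
Proof.
move=> Lf Lg; split=> [fg|].
  apply/norm1_eq0; first exact: L1B.
  by apply: filterS fg => x h Ix; rewrite h// subrr.
move/norm1_eq0 => /(_ (L1B Lf Lg)); apply: filterS => x h Ix.
by apply/eqP; rewrite -subr_eq0 h.
Qed.

(** Stated as an [aeq], positivity can be carried through maps that commute with absolute values. *)
Lemma ae_nonnegP f : ae_nonneg f <-> aeq (fun x => `|f x|) f.
Proof.
split; apply: filterS => x h Ix; first by rewrite ger0_norm// h.
by rewrite -h.
Qed.

End L1_theory.

(** * Renorming by a quadratic form *)

Section renorming.
Variable R : realType.
Implicit Types f g h : R -> R.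
Variable N2 : (R -> R) -> R.
Hypothesis N2_aeq : forall f g, L1 f -> L1 g -> aeq f g -> N2 f = N2 g.
Hypothesis N2_bound : forall f, L1 f -> 0 <= N2 f <= norm1 f ^+ 2.
Hypothesis N2Z : forall (a : R) f, L1 f -> N2 (fun x => a * f x) = a ^+ 2 * N2 f.
(** Weighted parallelogram identity; [a = b = 1] is the usual one. *)
Hypothesis N2_quad : forall (a b : R) f g, 0 <= a -> 0 <= b -> L1 f -> L1 g ->
  N2 (fun x => a * f x + b * g x) + a * b * N2 (fun x => f x - g x) =
  a * (a + b) * N2 f + b * (a + b) * N2 g.
Hypothesis N2_eq0 : forall f, L1 f -> N2 f = 0 -> aeq f (fun=> 0).

Definition renorm f := Num.sqrt (norm1 f ^+ 2 + N2 f).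

Let sqr_renorm f : L1 f -> renorm f ^+ 2 = norm1 f ^+ 2 + N2 f.
Proof.
move=> Lf; rewrite /renorm sqr_sqrtr// addr_ge0// ?sqr_ge0//.
by have /andP[] := N2_bound Lf.
Qed.

Let renorm_ge0 f : 0 <= renorm f. Proof. exact: sqrtr_ge0. Qed.

Let renorm_aeq f g : L1 f -> L1 g -> aeq f g -> renorm f = renorm g.
Proof.
by move=> Lf Lg fg; rewrite /renorm (aeq_norm1 Lf Lg fg) (N2_aeq Lf Lg fg).
Qed.

Let renormZ (a : R) f : L1 f -> renorm (fun x => a * f x) = `|a| * renorm f.
Proof.
move=> Lf; rewrite /renorm norm1Z// N2Z// exprMn real_normK ?num_real//.
by rewrite -mulrDr sqrtrM ?sqr_ge0// sqrtr_sqr.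
Qed.

(** The square of [norm1] is convex with defect at least [a b (norm1 f - norm1 g)^2], which is
    dropped; the quadratic part has the exact defect [a b N2 (f - g)], which is kept since strict
    convexity rests on it. *)
Let renorm_convex (a b : R) f g : 0 <= a -> 0 <= b -> a + b = 1 -> L1 f -> L1 g ->
  renorm (fun x => a * f x + b * g x) ^+ 2 + a * b * N2 (fun x => f x - g x)
  <= a * renorm f ^+ 2 + b * renorm g ^+ 2.
Proof.
move=> a0 b0 ab1 Lf Lg; rewrite !sqr_renorm//; last exact: L1_lin.
have := N2_quad a0 b0 Lf Lg; rewrite ab1 !mulr1 => quad.
have n1 : norm1 (fun x => a * f x + b * g x) <= a * norm1 f + b * norm1 g.
  apply: le_trans (norm1D (L1Z a Lf) (L1Z b Lg)) _.
  by rewrite !norm1Z// !ger0_norm.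
have : norm1 (fun x => a * f x + b * g x) ^+ 2 <= (a * norm1 f + b * norm1 g) ^+ 2.
  by rewrite ler_sqr ?nnegrE ?norm1_ge0// addr_ge0// mulr_ge0// norm1_ge0.
have -> : b = 1 - a by lra.
have : 0 <= a * (1 - a) * (norm1 f - norm1 g) ^+ 2.
  by rewrite mulr_ge0 ?sqr_ge0// mulr_ge0//; lra.
have bE : b = 1 - a by lra.
by move: quad; rewrite bE; nra.
Qed.

Let renorm_eq0 f : L1 f -> renorm f = 0 -> aeq f (fun=> 0).
Proof.
move=> Lf f0; have := sqr_renorm Lf; rewrite f0 expr0n/= => e.
have /andP[h _] := N2_bound Lf.
apply: N2_eq0 => //; have := sqr_ge0 (norm1 f); lra.
Qed.

(** Convexity of the square and homogeneity give the triangle inequality: with [s], [t] the two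
    values, [f + g] is the combination with weights [s / (s + t)] and [t / (s + t)] of multiples of
    [f] and [g] that both have value [s + t]. Vectors of value 0 are set apart because of the
    divisions. *)
Let renormD f g : L1 f -> L1 g -> renorm (fun x => f x + g x) <= renorm f + renorm g.
Proof.
move=> Lf Lg.
have [f0|f0] := eqVneq (renorm f) 0.
  rewrite f0 add0r le_eqVlt; apply/orP; left; apply/eqP.
  apply: renorm_aeq => //; first exact: L1D.
  by apply: filterS (renorm_eq0 Lf f0) => x h Ix; rewrite h// add0r.
have [g0|g0] := eqVneq (renorm g) 0.
  rewrite g0 addr0 le_eqVlt; apply/orP; left; apply/eqP.
  apply: renorm_aeq => //; first exact: L1D.
  by apply: filterS (renorm_eq0 Lg g0) => x h Ix; rewrite h// addr0.
have sf : 0 < renorm f by rewrite lt0r f0 renorm_ge0.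
have sg : 0 < renorm g by rewrite lt0r g0 renorm_ge0.
set s := renorm f in f0 sf *; set t := renorm g in g0 sg *.
have st0 : 0 < s + t by rewrite addr_gt0.
have st : s + t != 0 by rewrite gt_eqF.
have a0 : 0 <= s / (s + t) by rewrite divr_ge0// ltW.
have b0 : 0 <= t / (s + t) by rewrite divr_ge0// ltW.
have ab : s / (s + t) + t / (s + t) = 1 by rewrite -mulrDl divff.
have := renorm_convex a0 b0 ab (L1Z ((s + t) / s) Lf) (L1Z ((s + t) / t) Lg).
have A0 : 0 <= (s + t) / s by rewrite divr_ge0// ltW.
have B0 : 0 <= (s + t) / t by rewrite divr_ge0// ltW.
rewrite !renormZ// -/s -/t (ger0_norm A0) (ger0_norm B0) !divfK//.
rewrite (_ : (fun x => s / (s + t) * ((s + t) / s * f x) +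
    t / (s + t) * ((s + t) / t * g x)) = fun x => f x + g x); last first.
  by apply/funext => x; rewrite !mulrA !mulfVK// !divff// !mul1r.
rewrite -mulrDl ab mul1r => h.
rewrite -ler_sqr ?nnegrE ?renorm_ge0 ?(ltW st0)//.
apply: le_trans h; rewrite lerDl; apply: mulr_ge0; first exact: mulr_ge0.
by have /andP[] := N2_bound (L1B (L1Z ((s + t) / s) Lf) (L1Z ((s + t) / t) Lg)).
Qed.

Lemma renorm_equiv_norm : equiv_norm renorm.
Proof.
split; [exact: renorm_aeq|exact: renormD|exact: renormZ|].
(* The square lies between [norm1 f ^+ 2] and twice that; 2 is used in place of the square root of
   2. *)
exists 1, 2; split=> // f Lf; have /andP[h1 h2] := N2_bound Lf.
have n0 := norm1_ge0 f; have r0 := renorm_ge0 f; have := sqr_renorm Lf.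
by split; nra.
Qed.

(** At the midpoint the defect is [N2 (f - h) / 4], positive by definiteness. *)
Lemma renorm_strictly_convex : strictly_convex renorm.
Proof.
move=> f h Lf Lh nfh fhE.
have hf : 0 <= 2^-1 :> R by rewrite invr_ge0.
have h1 : 2^-1 + 2^-1 = 1 :> R by lra.
have := renorm_convex hf hf h1 Lf Lh.
rewrite (_ : (fun x => 2^-1 * f x + 2^-1 * h x) = fun x => (f x + h x) / 2); last first.
  by apply/funext => x; rewrite -mulrDr mulrC.
rewrite -fhE -mulrDl h1 mul1r => le.
rewrite -ltr_sqr ?nnegrE ?renorm_ge0//; apply: lt_le_trans le.
rewrite ltrDl mulr_gt0// ?mulr_gt0 ?invr_gt0// lt0r.
have /andP[-> _] := N2_bound (L1B Lf Lh); rewrite andbT.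
apply/eqP => /(N2_eq0 (L1B Lf Lh)) fh0; apply: nfh.
by apply: filterS fh0 => x e Ix; apply/eqP; rewrite -subr_eq0 e.
Qed.

End renorming.

(** * Primitives at rational points separate L1 *)

Section primitive.
Variable R : realType.
Local Notation leb := (@lebesgue_measure R).
Local Notation I01 := (`[(0:R), (1:R)]%classic : set R).
Implicit Types f g : R -> R.

(** Cutting [f] off to [0,1] and integrating from [-oo] puts it in the form to which the fundamental
    theorem of calculus applies. *)
Definition prim f (r : R) : R := \int[leb]_(x in `]-oo, r]) (f \_ I01) x.

Lemma prim_integrable f r : L1 f -> leb.-integrable `]-oo, r] (EFin \o (f \_ I01)).
Proof.
move=> Lf; have : leb.-integrable setT (EFin \o (f \_ I01)).
  rewrite -restrict_EFin; apply/(integrable_restrict leb _ _ _).1 => //.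
  by rewrite setTI.
by apply: integrableS => //; exact: measurable_itv.
Qed.

Lemma prim_lin (a b : R) f g r : L1 f -> L1 g ->
  prim (fun x => a * f x + b * g x) r = a * prim f r + b * prim g r.
Proof.
move=> Lf Lg; have If := prim_integrable r Lf; have Ig := prim_integrable r Lg.
have mI : measurable (`]-oo, r]%classic : set (measurableTypeR R)) by exact: measurable_itv.
rewrite /prim -!RintegralZl// -RintegralD//; last 2 first.
- exact: (integrableZl mI a If).
- exact: (integrableZl mI b Ig).
apply: eq_Rintegral => x _; rewrite /patch; case: ifP => // _.
by rewrite !mulr0 addr0.
Qed.

Lemma prim_le_norm1 f r : L1 f -> `|prim f r| <= norm1 f.
Proof.
move=> Lf; have If := prim_integrable r Lf.
apply: le_trans (le_normr_Rintegral _ If) _; first exact: measurable_itv.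
rewrite -lee_fin norm1E// /Rintegral fineK; last first.
  by apply: (@integrable_fin_num _ _ _ leb); [exact: measurable_itv|exact: integrable_abse If].
have -> : (\int[leb]_(x in `]-oo, r]) `|(f \_ I01) x|%:E =
    \int[leb]_(x in `]-oo, r]) ((fun x => `|f x|%:E) \_ I01) x)%E.
  by apply: eq_integral => x _; rewrite /patch; case: ifP => //; rewrite normr0.
rewrite -integral_mkcondr; apply: ge0_subset_integral => //.
- by apply: measurableI => //; exact: measurable_itv.
- exact: measurable_int (L1_norm Lf).
Qed.

Lemma prim_aeq f g r : L1 f -> L1 g -> aeq f g -> prim f r = prim g r.
Proof.
move=> Lf Lg fg; apply/eqP; rewrite -subr_eq0 -normr_le0.
have -> : prim f r - prim g r = prim (fun x => 1 * f x + (- 1) * g x) r.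
  by rewrite prim_lin// mul1r mulN1r.
apply: le_trans (prim_le_norm1 _ (L1_lin 1 (- 1) Lf Lg)) _.
have /aeqP h := fg; rewrite -(h Lf Lg) le_eqVlt; apply/orP; left; apply/eqP.
by apply: eq_norm1 => x; rewrite mul1r mulN1r.
Qed.

(** At almost every [x] the primitive is differentiable with derivative [f x]. Rationals just to the
    right of [x] show that it vanishes at [x], by continuity, and then that difference quotients
    arbitrarily close to [x] vanish, which excludes a nonzero derivative. *)
Lemma prim_rat_eq0 f : L1 f -> (forall q : rat, prim f (ratr q) = 0) ->
  aeq f (fun=> 0).
Proof.
move=> Lf f0.
have := FTC1Ny (fun y => prim_integrable y Lf)
  (integrable_locally (@measurable_I01 R) Lf).
apply: filterS => x [dx Fx] Ix.
have fE : (f \_ I01) x = f x by rewrite patchE mem_set.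
rewrite -fE; apply: contrapT => /eqP fx0.
have F0 : prim f x = 0.
  apply: contrapT => /eqP Fx0.
  have cF : {for x, continuous (prim f)}.
    exact/differentiable_continuous/derivable1_diffP.
  have [e /= e0 xe] := (nbhs_ballP _ _).1 (cvgr_neq0 _ cF Fx0).
  have [q] : exists q : rat, ratr q \in `]x, x + e[.
    by apply: rat_in_itvoo; rewrite ltrDl.
  rewrite in_itv/= => /andP[xq qe].
  have := xe (ratr q); rewrite /ball/= ltr0_norm ?subr_lt0// opprB f0 eqxx.
  by rewrite ltrBlDl qe => /(_ isT).
have dF : h^-1 *: (prim f (h + x) - prim f x) @[h --> 0^'] --> (f \_ I01) x.
  rewrite -Fx /derive1; move: dx; rewrite /derivable -/(prim f).
  have -> : (fun h : R => h^-1 *: ((prim f \o shift x) (h *: 1) - prim f x)) =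
    (fun h : R => h^-1 *: (prim f (h + x) - prim f x)); last by [].
  by apply/funext => h; rewrite /= [h *: 1]mulr1.
have [e /= e0 xe] := (nbhs_ballP _ _).1 (cvgr_neq0 _ dF fx0).
have [q] : exists q : rat, ratr q \in `]x, x + e[.
  by apply: rat_in_itvoo; rewrite ltrDl.
rewrite in_itv/= => /andP[xq qe].
have := xe (ratr q - x); rewrite /ball/= sub0r normrN gtr0_norm ?subr_gt0//.
rewrite subrK f0 F0 subrr scaler0 eqxx ltrBlDl => /(_ qe).
by move=> /(_ _)/=; rewrite subr_eq0 gt_eqF// => /(_ isT).
Qed.

End primitive.

(** * A positive definite quadratic form on L1 *)

Section quadratic_form.
Variable R : realType.

Lemma esum_ge_term (T : choiceType) (u : T -> \bar R) t :
  (forall t, 0 <= u t)%E -> (u t <= \esum_(t in [set: T]) u t)%E.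
Proof.
by move=> u0; apply: esum_ge; exists [set t] => //; rewrite fsbig_set1.
Qed.

Lemma esum_inj_le (T : choiceType) (e : T -> nat) (u : nat -> \bar R) :
  injective e -> (forall n, 0 <= u n)%E ->
  (\esum_(t in [set: T]) u (e t) <= \sum_(n <oo) u n)%E.
Proof.
move=> ie u0; rewrite -(esum_image setT e) => [|x y _ _]; last exact: ie.
rewrite nneseries_esumT// esum_mkcond; apply: le_esum => n _.
by case: ifP.
Qed.

(** Weights of total mass at most 1 on any set numbered injectively; they serve over the rationals
    in [sqprim] and over [G] for a positive probability. *)
Definition dyad (n : nat) : R := 1 / (2 ^ n.+1)%:R.

Lemma dyad_gt0 n : 0 < dyad n.
Proof. by rewrite divr_gt0// ltr0n expn_gt0. Qed.

Lemma esum_dyad_le1 (T : choiceType) (e : T -> nat) : injective e ->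
  (\esum_(t in [set: T]) (dyad (e t))%:E <= 1)%E.
Proof.
move=> ie; apply: le_trans (esum_inj_le (u := fun n => (dyad n)%:E) ie _) _.
  by move=> n; rewrite lee_fin ltW ?dyad_gt0.
exact: epsilon_trick0.
Qed.

Implicit Types f g : R -> R.

(** The form [q] of the overview. It is finite because the primitives are bounded by [norm1], and
    definite by [prim_rat_eq0]. *)
Definition sqprim f : \bar R :=
  \esum_(q in [set: rat]) (dyad (pickle q) * prim f (ratr q) ^+ 2)%:E.

Lemma sqprim_term_ge0 f q : (0 <= (dyad (pickle q) * prim f (ratr q) ^+ 2)%:E)%E.
Proof. by rewrite lee_fin mulr_ge0 ?sqr_ge0// ltW ?dyad_gt0. Qed.

Lemma sqprim_ge0 f : (0 <= sqprim f)%E.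
Proof. by apply: esum_ge0 => q _; exact: sqprim_term_ge0. Qed.

Lemma sqprim_aeq f g : L1 f -> L1 g -> aeq f g -> sqprim f = sqprim g.
Proof.
by move=> Lf Lg fg; apply: eq_esum => q _; rewrite (prim_aeq _ Lf Lg fg).
Qed.

Lemma sqprim_le f : L1 f -> (sqprim f <= (norm1 f ^+ 2)%:E)%E.
Proof.
move=> Lf; apply: (@le_trans _ _
  ((norm1 f ^+ 2)%:E * \esum_(q in [set: rat]) (dyad (pickle q))%:E)%E).
  rewrite -esumZl ?sqr_ge0//; last by move=> q; rewrite lee_fin ltW ?dyad_gt0.
  apply: le_esum => q _; rewrite -EFinM lee_fin mulrC ler_wpM2r ?(ltW (dyad_gt0 _))//.
  by rewrite -real_normK ?num_real// ler_sqr ?nnegrE ?norm1_ge0// prim_le_norm1.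
rewrite -[leRHS]mule1 lee_wpmul2l ?lee_fin ?sqr_ge0//.
by apply: esum_dyad_le1; exact: (pcan_inj pickleK).
Qed.

(** Termwise this is [(a u + b v)^2 + a b (u - v)^2 = a (a + b) u^2 + b (a + b) v^2]; nonnegative
    [a] and [b] allow the extended sums to be scaled and added. *)
Lemma sqprim_quad (a b : R) f g : 0 <= a -> 0 <= b -> L1 f -> L1 g ->
  (sqprim (fun x => a * f x + b * g x)%R +
     (a * b)%:E * sqprim (fun x => f x - g x)%R =
   (a * (a + b))%:E * sqprim f + (b * (a + b))%:E * sqprim g)%E.
Proof.
move=> a0 b0 Lf Lg.
have ge0 (c : R) h (q : rat) : 0 <= c ->
    (0 <= c%:E * (dyad (pickle q) * prim h (ratr q) ^+ 2)%:E)%E.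
  by move=> c0; apply: mule_ge0; [rewrite lee_fin|exact: sqprim_term_ge0].
have ge0' := sqprim_term_ge0.
have ab0 := mulr_ge0 a0 b0; have aab0 := mulr_ge0 a0 (addr_ge0 a0 b0).
have bab0 := mulr_ge0 b0 (addr_ge0 a0 b0).
rewrite /sqprim -!esumZl// -!esumD//; do ?by move=> q _; exact: ge0.
apply: eq_esum => q _; rewrite -!EFinM -!EFinD prim_lin//.
have -> : prim (fun x => f x - g x) (ratr q) = prim f (ratr q) - prim g (ratr q).
  have := prim_lin 1 (- 1) (ratr q) Lf Lg; rewrite mul1r mulN1r => <-.
  by congr prim; apply/funext => x; rewrite mul1r mulN1r.
by congr EFin; ring.
Qed.

Lemma sqprimZ (a : R) f : L1 f -> sqprim (fun x => a * f x) = ((a ^+ 2)%:E * sqprim f)%E.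
Proof.
move=> Lf; rewrite /sqprim -esumZl ?sqr_ge0//; last first.
  by move=> q; exact: sqprim_term_ge0.
apply: eq_esum => q _; rewrite -EFinM.
have -> : prim (fun x => a * f x) (ratr q) = a * prim f (ratr q).
  have := prim_lin a 0 (ratr q) Lf Lf; rewrite mul0r addr0 => <-.
  by congr prim; apply/funext => x; rewrite mul0r addr0.
by congr EFin; ring.
Qed.

Lemma sqprim_eq0 f : L1 f -> sqprim f = 0%E -> aeq f (fun=> 0).
Proof.
move=> Lf f0; apply: prim_rat_eq0 => // q.
have := esum_ge_term q (sqprim_term_ge0 f); rewrite -/(sqprim f) f0 lee_fin.
rewrite pmulr_rle0 ?dyad_gt0// => h; apply/eqP; rewrite -sqrf_eq0.
by rewrite eq_le h sqr_ge0.
Qed.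

End quadratic_form.

(** * Spreading L1 over l1(G; L1) *)

Section change_of_variables.
Variable R : realType.
Local Notation leb := (@lebesgue_measure R).
Local Notation J := (`[(0:R), (1:R)[%classic : set R).
Local Notation RB := (measurableTypeR R).

Lemma measurable_affine (a c : R) :
  measurable_fun setT ((fun t => a + c * t) : RB -> RB).
Proof.
apply: measurable_funD; first exact: measurable_cst.
by apply: measurable_funM; [exact: measurable_cst|exact: measurable_id].
Qed.

(** The image of Lebesgue measure under [t |-> a + c t], scaled by [c], agrees with Lebesgue measure
    on half-open intervals and hence everywhere. *)
Lemma integral_affine (a c : R) (u : RB -> \bar R) : 0 < c ->
  measurable_fun setT u -> (forall x, 0 <= u x)%E ->
  (\int[leb]_(x in `[a, (a + c)%R[) u x =
   c%:E * \int[leb]_(t in J) u (a + c * t)%R)%E.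
Proof.
move=> c0 mu u0; pose phi : RB -> RB := fun t => a + c * t.
have mphi : measurable_fun setT phi by exact: measurable_affine.
have cNN : 0 <= c by exact: ltW.
have [pf pfE] : exists pf : {measure set RB -> \bar R},
    (pf : set RB -> \bar R) = pushforward leb phi.
  by exists (measure_function_pushforward__canonical__measure_function_Measure leb mphi).
pose nu : {measure set RB -> \bar R} := mscale (NngNum cNN) pf.
have phiE (x y : R) (bx by_ : bool) : phi @^-1` [set` Interval (BSide bx x) (BSide by_ y)] =
    [set` Interval (BSide bx ((x - a) / c)) (BSide by_ ((y - a) / c))].
  apply/seteqP; split=> t; case: bx by_ => -[]; rewrite /= !in_itv/=
    ?(ler_pdivrMr, ler_pdivlMr, ltr_pdivrMr, ltr_pdivlMr)//
    ?(lerBlDl, lerBrDl, ltrBlDl, ltrBrDl) /phi ?(mulrC c)//.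
have ocE (X : set RB) : ocitv X -> leb X = nu X.
  move=> [[x y] _ <-] /=.
  rewrite /nu/= /mscale pfE /pushforward phiE !lebesgue_measure_itv/= !lte_fin.
  rewrite ltr_pM2r ?invr_gt0// ltrD2r; case: ifP => // _.
    rewrite -!EFinD -EFinM; congr EFin; field; lra.
  by rewrite mule0.
have nuE := lebesgue_measure_unique ocE.
rewrite (eq_measure_integral nu); last by move=> A mA _; exact: nuE.
have mI : measurable (`[a, a + c[%classic : set RB) by exact: measurable_itv.
rewrite ge0_integral_mscale//; last exact: measurable_funTS.
rewrite pfE ge0_integral_pushforward//; last exact: measurable_funTS.
by rewrite phiE subrr mul0r addrAC subrr add0r divff// gt_eqF.
Qed.

Variable q : nat -> R.
Hypothesis q0 : forall k, 0 <= q k.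
Hypothesis q1 : (\sum_(k <oo) (q k)%:E = 1)%E.

(** Left endpoints of consecutive pieces [[psum k, psum k.+1[] of length [q k]; a piece with
    [q k = 0] is empty. *)
Definition psum k := \sum_(i < k) q i.

Lemma psumS k : psum k.+1 = psum k + q k.
Proof. by rewrite /psum big_ord_recr. Qed.

Lemma psum_ge0 k : 0 <= psum k.
Proof. by apply: sumr_ge0. Qed.

Lemma psum_mono k l : (k <= l)%N -> psum k <= psum l.
Proof.
move=> /subnK <-; elim: (l - k)%N => [|d ih]//.
by rewrite addSn psumS (le_trans ih)// lerDl.
Qed.

Lemma psum_le1 k : psum k <= 1.
Proof.
rewrite -lee_fin -q1 /psum -sumEFin -(big_mkord xpredT (fun i => (q i)%:E)).
by apply: nneseries_lim_ge => i _ _; rewrite lee_fin.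
Qed.

(** Infinitely many pieces exhaust only the half-open interval, which is why the spreads are built
    on [[0, 1[]. *)
Lemma psum_cover x : 0 <= x < 1 -> exists k, psum k <= x < psum k.+1.
Proof.
move=> /andP[x0 x1].
have exK : exists k, x < psum k.
  apply: contrapT => nk; move: x1; apply/negP; rewrite -leNgt -lee_fin -q1.
  apply: lime_le; first by apply: is_cvg_nneseries => i _ _; rewrite lee_fin.
  apply: nearW => k; rewrite big_mkord sumEFin lee_fin leNgt; apply/negP => h.
  by apply: nk; exists k.
have [k xk mink] := ex_minnP exK.
case: k xk mink => [|k] xk mink; first by move: xk; rewrite /psum big_ord0 ltNge x0.
exists k; rewrite xk andbT leNgt; apply/negP => /mink.
by rewrite ltnn.
Qed.

Lemma psum_inj x k l : psum k <= x < psum k.+1 -> psum l <= x < psum l.+1 -> k = l.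
Proof.
move=> /andP[k1 k2] /andP[l1 l2]; case: (ltngtP k l) => // kl.
- by have := lt_le_trans k2 (le_trans (psum_mono kl) l1); rewrite ltxx.
- by have := lt_le_trans l2 (le_trans (psum_mono kl) k1); rewrite ltxx.
Qed.

Lemma integral_partition (u : RB -> \bar R) :
  measurable_fun setT u -> (forall x, 0 <= u x)%E ->
  (\int[leb]_(x in J) u x =
   \sum_(k <oo) ((q k)%:E * \int[leb]_(t in J) u (psum k + q k * t)%R))%E.
Proof.
move=> mu u0.
have JE : J = \bigcup_k `[psum k, psum k.+1[%classic.
  apply/seteqP; split=> [x /=|x [k _]] /=; rewrite !in_itv/=.
    by move=> /psum_cover[k kx]; exists k => //=; rewrite in_itv.
  move=> /andP[h1 h2]; rewrite (le_trans (psum_ge0 k))//=.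
  exact: lt_le_trans h2 (psum_le1 _).
rewrite [in LHS]JE ge0_integral_bigcup//; last 2 first.
- exact: measurable_funTS.
- apply/trivIsetP => k l _ _ kl; rewrite -subset0 => x [/=].
  rewrite !in_itv/= => hk hl; move: kl; rewrite (psum_inj hk hl).
  by rewrite eqxx.
apply: eq_eseriesr => k _; rewrite psumS.
have [->|qk] := eqVneq (q k) 0.
  by rewrite addr0 set_itvco0 integral_set0 mul0e.
by rewrite integral_affine// lt0r qk q0.
Qed.

End change_of_variables.

(** * Affine rescaling inside the cells of a grid *)

Section spread.
Variable R : realType.
Local Notation leb := (@lebesgue_measure R).
Local Notation I01 := (`[(0:R), (1:R)]%classic : set R).
Local Notation J := (`[(0:R), (1:R)[%classic : set R).
Local Notation RB := (measurableTypeR R).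

Lemma measurable_floor_real :
  measurable_fun setT ((fun x => (Num.floor x)%:~R) : RB -> RB).
Proof.
apply: (measurability _ (RGenCInfty.measurableE R)) => _ [_ [a ->] <-].
rewrite setTI.
rewrite (_ : _ @^-1` _ = `[(Num.ceil a)%:~R, +oo[%classic); first exact: measurable_itv.
apply/seteqP; split=> x /=; rewrite !in_itv/= !andbT.
  by rewrite -ceil_le_int floor_ge_int.
by rewrite -floor_ge_int ceil_le_int.
Qed.

Variable n : nat.
Local Notation m := (n.+1%:R : R).

(** Index, kept as a real, of the cell of mesh [1 / m] containing [x]; with the relative position
    [offset x] one has [x = (cell x + offset x) / m]. *)
Definition cell (x : R) : R := (Num.floor (m * x))%:~R.
Definition offset (x : R) : R := m * x - cell x.

Lemma offset_itv x : 0 <= offset x < 1.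
Proof.
rewrite /offset /cell subr_ge0 floor_le_tmp/= ltrBlDl.
by have := floorD1_gt (m * x); rewrite intrD.
Qed.

Lemma measurable_cell : measurable_fun setT (cell : RB -> RB).
Proof.
apply: (measurableT_comp measurable_floor_real).
by apply: measurable_funM; [exact: measurable_cst|exact: measurable_id].
Qed.

Lemma measurable_offset : measurable_fun setT (offset : RB -> RB).
Proof.
apply: measurable_funB; last exact: measurable_cell.
by apply: measurable_funM; [exact: measurable_cst|exact: measurable_id].
Qed.

Lemma cell_shift (z : int) (r : R) : 0 <= r < 1 -> cell ((z%:~R + r) / m) = z%:~R.
Proof.
move=> /andP[r0 r1]; rewrite /cell mulrCA divff ?mulr1 ?pnatr_eq0//.
congr intr; apply: floor_def; rewrite lerDl r0/= intrD ltrD2l.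
by [].
Qed.

Lemma offset_shift (z : int) (r : R) : 0 <= r < 1 -> offset ((z%:~R + r) / m) = r.
Proof.
move=> r01; rewrite /offset cell_shift// mulrCA divff ?mulr1 ?pnatr_eq0//.
by rewrite addrAC subrr add0r.
Qed.

Lemma J_shift x (r : R) : J x -> 0 <= r < 1 -> J ((cell x + r) / m).
Proof.
rewrite /= !in_itv/= => /andP[x0 x1] /andP[r0 r1].
have c0 : 0 <= cell x by rewrite /cell ler0z floor_ge0 mulr_ge0.
have c1 : cell x + 1 <= m.
  rewrite /cell -(intrD _ _ 1) -[m]/(n.+1%:Z%:~R) ler_int lezD1 floor_lt_int.
  by rewrite -[ltRHS]mulr1 ltr_pM2l.
rewrite divr_ge0 ?addr_ge0//= ltr_pdivrMr// mul1r.
by apply: lt_le_trans c1; rewrite ltrD2l.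
Qed.

(** Fixes the cell and applies [t |-> a + c t] to the relative position. With [psum p k] and [p k]
    it maps each cell onto its [k]-th piece. *)
Definition regrid (a c x : R) : R := (cell x + (a + c * offset x)) / m.

Lemma measurable_regrid a c : measurable_fun setT (regrid a c : RB -> RB).
Proof.
apply: measurable_funM; last exact: measurable_cst.
apply: measurable_funD; first exact: measurable_cell.
apply: measurable_funD; first exact: measurable_cst.
by apply: measurable_funM; [exact: measurable_cst|exact: measurable_offset].
Qed.

Variable p : nat -> R.
Hypothesis p0 : forall k, 0 <= p k.
Hypothesis p1 : (\sum_(k <oo) (p k)%:E = 1)%E.

Lemma psum_offset_itv k (r : R) : 0 <= r < 1 -> 0 < p k ->
  psum p k <= psum p k + p k * r < psum p k.+1.
Proof.
move=> /andP[r0 r1] pk; rewrite psumS lerDl mulr_ge0//= ltrD2l.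
by rewrite -[ltRHS]mulr1 ltr_pM2l.
Qed.

Lemma psum_offset01 k (r : R) : 0 <= r < 1 -> 0 < p k -> 0 <= psum p k + p k * r < 1.
Proof.
move=> r01 pk; have /andP[h1 h2] := psum_offset_itv r01 pk.
rewrite (le_trans (psum_ge0 p0 k))//=.
exact: lt_le_trans h2 (psum_le1 p0 p1 _).
Qed.

(** The grid seen as the partition attached to a probability on [nat], so that [integral_partition]
    serves for the cells as well as inside one. *)
Definition unif (i : nat) : R := if (i < n.+1)%N then m^-1 else 0.

Lemma unif_ge0 i : 0 <= unif i.
Proof. by rewrite /unif; case: ifP => // _; rewrite invr_ge0. Qed.

Lemma unif_sum : (\sum_(i <oo) (unif i)%:E = 1)%E.
Proof.
rewrite (nneseries_split 0 n.+1); last by move=> k _; rewrite lee_fin unif_ge0.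
rewrite eseries0; last by move=> i h _; rewrite /unif ltnNge; move: h; rewrite add0n => ->.
rewrite adde0 add0n big_mkord sumEFin; congr EFin.
rewrite (eq_bigr (fun=> m^-1)) => [|i _]; last by rewrite /unif ltn_ord.
by rewrite sumr_const card_ord -[LHS]mulr_natl divff// pnatr_eq0.
Qed.

Lemma psum_unif i : (i < n.+1)%N -> psum unif i = i%:R / m.
Proof.
move=> im; rewrite /psum (eq_bigr (fun=> m^-1)) => [|j _]; last first.
  by rewrite /unif (ltn_trans (ltn_ord j)).
by rewrite sumr_const card_ord -[LHS]mulr_natl.
Qed.

(** Both sides are split over the cells by [integral_partition] for [unif]. On a cell [regrid] is
    affine, so after exchanging the sums over pieces and cells the claim is [integral_partition] for
    [p]. *)
Lemma integral_regrid (u : RB -> \bar R) :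
  measurable_fun setT u -> (forall x, 0 <= u x)%E ->
  (\sum_(k <oo) ((p k)%:E * \int[leb]_(x in J) u (regrid (psum p k) (p k) x)) =
   \int[leb]_(x in J) u x)%E.
Proof.
move=> mu u0.
have mug a c : measurable_fun setT (u \o regrid a c : RB -> \bar R).
  exact: (measurableT_comp mu (measurable_regrid a c)).
have inner k : ((p k)%:E * \int[leb]_(x in J) u (regrid (psum p k) (p k) x) =
    \sum_(i <oo) ((p k)%:E * ((unif i)%:E *
      \int[leb]_(t in J) u (psum unif i + unif i * (psum p k + p k * t))%R)))%E.
  have [->|pk] := eqVneq (p k) 0.
    by rewrite mul0e eseries0// => i _ _; rewrite mul0e.
  have pk0 : 0 < p k by rewrite lt0r pk p0.
  have /= -> := integral_partition unif_ge0 unif_sum (mug (psum p k) (p k))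
    (fun x => u0 _).
  rewrite [RHS]nneseriesZl; last first.
    by move=> i _; rewrite mule_ge0 ?lee_fin ?unif_ge0// integral_ge0.
  congr (_ * _)%E; apply: eq_eseriesr => i _.
  have [im|im] := ltnP i n.+1; last by rewrite /unif ltnNge im/= !mul0e.
  congr (_ * _)%E; apply: eq_integral => t; rewrite inE/= in_itv/= => t01.
  congr u; rewrite psum_unif// /unif im /regrid.
  rewrite -[i%:R]/(i%:Z%:~R) [_^-1 * t]mulrC -mulrDl cell_shift// offset_shift//.
  by rewrite mulrDl [m^-1 * _]mulrC.
under eq_eseriesr do rewrite inner.
rewrite nneseries_interchange; last first.
  by move=> k i; rewrite !mule_ge0 ?lee_fin ?unif_ge0// integral_ge0.
rewrite (integral_partition unif_ge0 unif_sum mu u0).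
apply: eq_eseriesr => i _.
under eq_eseriesr do rewrite muleCA.
rewrite nneseriesZl; last first.
  by move=> k _; rewrite mule_ge0 ?lee_fin// integral_ge0.
congr (_ * _)%E; apply/esym.
exact: (integral_partition p0 p1
  (measurableT_comp mu (measurable_affine (psum unif i) (unif i))) (fun x => u0 _)).
Qed.

End spread.

(** * The spread is a surjective lattice isometry *)

Section spread_isometry.
Variable R : realType.
Local Notation leb := (@lebesgue_measure R).
Local Notation I01 := (`[(0:R), (1:R)]%classic : set R).
Local Notation J := (`[(0:R), (1:R)[%classic : set R).
Local Notation RB := (measurableTypeR R).
Implicit Types f g : R -> R.

Lemma measurable_J : measurable (J : set RB).
Proof. exact: measurable_itv. Qed.

Lemma sub_J_I01 x : J x -> I01 x.
Proof. by rewrite /= !in_itv/= => /andP[-> /ltW]. Qed.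

Lemma L1_measurable_J f : L1 f -> measurable_fun setT (f \_ J : RB -> R).
Proof.
move=> /L1_measurable mf; apply/(measurable_restrictT _ _).1; first exact: measurable_J.
by apply: measurable_funS mf; [exact: measurable_I01|exact: sub_J_I01].
Qed.

Lemma norm1J f : L1 f -> ((norm1 f)%:E = \int[leb]_(x in J) `|f x|%:E)%E.
Proof.
move=> Lf; rewrite norm1E// [RHS]integral_itv_bndo_bndc//.
apply: (@measurable_funS _ _ RB _ I01); [exact: measurable_I01|exact: sub_J_I01|].
exact: measurable_int (L1_norm Lf).
Qed.

Lemma L1_of_J f : measurable_fun setT (f : RB -> R) ->
  (\int[leb]_(x in J) `|f x|%:E < +oo)%E -> L1 f.
Proof.
move=> mf fi; apply: L1P; first exact: measurable_funTS.
rewrite -integral_itv_bndo_bndc//; apply: measurable_funTS.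
by apply/measurable_EFinP; apply: measurableT_comp.
Qed.

Lemma aeq_J f g : (forall x, J x -> f x = g x) -> aeq f g.
Proof.
move=> fg; exists [set 1]; split.
- exact: measurable_set1.
- by rewrite lebesgue_measure_set1.
move=> x /= nfg; apply: contrapT => x1; apply: nfg => Ix; apply: fg.
move: Ix; rewrite /= !in_itv/= lt_neqAle => /andP[-> ->]; rewrite andbT.
by apply/eqP.
Qed.

Variable p : nat -> R.
Hypothesis p0 : forall k, 0 <= p k.
Hypothesis p1 : (\sum_(k <oo) (p k)%:E = 1)%E.

Section fixed_grid.
Variable n : nat.
Local Notation m := (n.+1%:R : R).

(** The factor [p k] is the Jacobian that preserves mass when the [k]-th pieces are stretched to
    whole cells. *)
Definition spread f (k : nat) (x : R) : R :=
  p k * (f \_ J) (regrid n (psum p k) (p k) x).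

Lemma spread_lin (a b : R) f g k :
  spread (fun x => a * f x + b * g x) k =
  (fun x => a * spread f k x + b * spread g k x).
Proof.
apply/funext => x; rewrite /spread /patch; case: ifP => _; last by rewrite !mulr0 addr0.
by ring.
Qed.

Lemma spread_normr f k : spread (fun x => `|f x|) k = (fun x => `|spread f k x|).
Proof.
apply/funext => x; rewrite /spread normrM (ger0_norm (p0 k)) /patch.
by case: ifP => // _; rewrite normr0.
Qed.

Lemma measurable_spread f k : L1 f -> measurable_fun setT (spread f k : RB -> R).
Proof.
move=> Lf; apply: measurable_funM; first exact: measurable_cst.
exact: measurableT_comp (L1_measurable_J Lf) (measurable_regrid _ _ _).
Qed.

Let spread_integral f : L1 f ->
  (\sum_(k <oo) \int[leb]_(x in J) `|spread f k x|%:E = (norm1 f)%:E)%E.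
Proof.
move=> Lf; have mf := L1_measurable_J Lf.
have mh : measurable_fun setT ((fun y => `|(f \_ J) y|%:E) : RB -> \bar R).
  by apply/measurable_EFinP; apply: measurableT_comp.
rewrite norm1J//.
transitivity (\int[leb]_(x in J) `|(f \_ J) x|%:E)%E; last first.
  by apply: eq_integral => x Jx; rewrite patchE Jx.
rewrite -(integral_regrid n p0 p1 mh); last by move=> x; rewrite lee_fin.
apply: eq_eseriesr => k _.
have mk : measurable_fun (J : set RB)
    (fun x : RB => `|(f \_ J) (regrid n (psum p k) (p k) x)|%:E).
  apply: measurable_funTS.
  exact: (measurableT_comp mh (measurable_regrid n (psum p k) (p k))).
rewrite -(ge0_integralZl leb measurable_J mk) ?lee_fin//.
by apply: eq_integral => x _; rewrite /spread normrM (ger0_norm (p0 k)) EFinM.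
Qed.

Lemma L1_spread f k : L1 f -> L1 (spread f k).
Proof.
move=> Lf; apply: L1_of_J; first exact: measurable_spread.
have ge0 l : (0 <= \int[leb]_(x in J) `|spread f l x|%:E)%E by exact: integral_ge0.
apply: le_lt_trans (ltry (norm1 f)); rewrite -(spread_integral Lf).
rewrite nneseries_esumT//.
exact: (esum_ge_term (u := fun l => \int[leb]_(x in J) `|spread f l x|%:E)%E).
Qed.

Lemma spread_isometry f : L1 f ->
  (\sum_(k <oo) (norm1 (spread f k))%:E = (norm1 f)%:E)%E.
Proof.
move=> Lf; rewrite -(spread_integral Lf); apply: eq_eseriesr => k _.
by rewrite norm1J//; exact: L1_spread.
Qed.

Lemma spread_surj (F : nat -> R -> R) : (forall k, L1 (F k)) ->
  (\sum_(k <oo) (norm1 (F k))%:E < +oo)%E ->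
  exists2 f, L1 f & forall k, 0 < p k -> aeq (spread f k) (F k).
Proof.
move=> LF Fy.
pose idx y := xget 0%N [set k | psum p k <= offset n y < psum p k.+1].
have idxE y k : psum p k <= offset n y < psum p k.+1 -> idx y = k.
  move=> h; have hi := @xgetPex _ 0%N [set k | psum p k <= offset n y < psum p k.+1]
    (ex_intro _ k h).
  exact: (psum_inj p0 hi h).
pose chi k := regrid n (- (psum p k / p k)) (p k)^-1.
pose f0 y := (F (idx y) \_ J) (chi (idx y) y) / p (idx y).
have spreadE k x : 0 < p k -> J x -> spread f0 k x = F k x.
  move=> pk Jx; rewrite /spread; set y := regrid _ _ _ _.
  have r01 := psum_offset01 p0 p1 (offset_itv n x) pk.
  have Jy : J y by exact: J_shift.
  have oy : offset n y = psum p k + p k * offset n x by rewrite /y /regrid offset_shift.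
  have cy : cell n y = cell n x by rewrite /y /regrid cell_shift.
  rewrite patchE mem_set// /f0.
  have -> : idx y = k by apply: idxE; rewrite oy; exact: psum_offset_itv (offset_itv n x) pk.
  have -> : chi k y = x.
    rewrite /chi /regrid oy cy.
    have -> : - (psum p k / p k) + (p k)^-1 * (psum p k + p k * offset n x) = offset n x.
      by field; rewrite gt_eqF.
    by rewrite /offset addrC subrK mulrC mulrA mulVf ?mul1r// pnatr_eq0.
  by rewrite patchE mem_set// mulrC divfK// gt_eqF.
have mf0 : measurable_fun (J : set RB) (f0 : RB -> R).
  (* On each of these countably many pieces [idx] is constant. *)
  have -> : J = \bigcup_k (J `&` offset n @^-1` `[psum p k, psum p k.+1[%classic).
    apply/seteqP; split=> [x Jx|x [k _ []]//].
    have [k hk] := psum_cover p0 p1 (offset_itv n x).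
    by exists k => //; split => //=; rewrite in_itv.
  apply/measurable_fun_bigcup => [k|k].
    have mo : measurable
        ((offset n : RB -> RB) @^-1` `[psum p k, psum p k.+1[%classic : set RB).
      by rewrite -[X in measurable X]setTI; exact: (measurable_offset n measurableT).
    exact: (measurableI _ _ measurable_J mo).
  apply: (@eq_measurable_fun _ _ RB R _ (fun y => (F k \_ J) (chi k y) / p k)).
    move=> y; rewrite inE/= => -[_]; rewrite in_itv/= => /idxE.
    by rewrite /f0 => ->.
  apply: measurable_funTS; apply: measurable_funM; last exact: measurable_cst.
  exact: (measurableT_comp (L1_measurable_J (LF k)) (measurable_regrid _ _ _)).
pose f := f0 \_ J.
have fJ : f \_ J = f by rewrite /f -patch_setI setIid.
have spf k : spread f k = spread f0 k by apply/funext => x; rewrite /spread fJ.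
have mf : measurable_fun setT (f : RB -> R).
  by apply/(measurable_restrictT _ _).1 => //; exact: measurable_J.
have mh : measurable_fun setT ((fun y => `|f y|%:E) : RB -> \bar R).
  by apply/measurable_EFinP; apply: measurableT_comp.
exists f; last by move=> k pk; apply: aeq_J => x Jx; rewrite spf; exact: spreadE.
apply: L1_of_J => //; apply: le_lt_trans Fy.
rewrite -(integral_regrid n p0 p1 mh); last by move=> x; rewrite lee_fin.
apply: lee_nneseries => [k _ _|k _].
  by rewrite mule_ge0 ?lee_fin// integral_ge0.
have [->|pk] := eqVneq (p k) 0; first by rewrite mul0e lee_fin norm1_ge0.
have pk0 : 0 < p k by rewrite lt0r pk p0.
have mk : measurable_fun (J : set RB)
    (fun x : RB => `|f (regrid n (psum p k) (p k) x)|%:E).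
  apply: measurable_funTS.
  exact: (measurableT_comp mh (measurable_regrid n (psum p k) (p k))).
rewrite -(ge0_integralZl leb measurable_J mk) ?lee_fin// norm1J//.
rewrite le_eqVlt; apply/orP; left; apply/eqP; apply: eq_integral => x.
rewrite inE => Jx; rewrite -(spreadE k x pk0 Jx) -spf /spread fJ.
by rewrite normrM (ger0_norm (p0 k)) EFinM.
Qed.

End fixed_grid.

End spread_isometry.

(** * Strong convergence of the spreads under refinement *)

Section spread_approx.
Variable R : realType.
Local Notation leb := (@lebesgue_measure R).
Local Notation I01 := (`[(0:R), (1:R)]%classic : set R).
Local Notation J := (`[(0:R), (1:R)[%classic : set R).
Implicit Types f g : R -> R.

Lemma uniformly_continuous_I01 g (e : R) : continuous g -> 0 < e ->
  exists2 d : R, 0 < d & forall x y, I01 x -> `|x - y| < d -> `|g x - g y| < e.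
Proof.
move=> cg e0.
have /compact_near_coveringP := @segment_compact R 0 1.
move=> /(_ R (0^'+) (fun d x => forall y, `|x - y| < d -> `|g x - g y| < e)).
case=> [x _|d /= d0 hd].
  have e2 : 0 < e / 2 by rewrite divr_gt0.
  have /cvgrPdist_lt /(_ _ e2) /nbhs_ballP [r /= r0 hr] := cg x.
  exists (ball x (r / 2), ball 0 (r / 2)) => /=.
    split; first by apply: nbhsx_ballx; rewrite divr_gt0.
    by exists (r / 2); rewrite /= ?divr_gt0.
  move=> [x' d] /= [xx' dd] y x'y.
  have h1 : `|g x - g x'| < e / 2.
    by apply: hr; rewrite /ball/=; apply: lt_le_trans xx' _; rewrite ler_piMr ?ltW//; lra.
  have h2 : `|g x - g y| < e / 2.
    apply: hr; rewrite /ball/=; apply: le_lt_trans (ler_distD x' _ _) _.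
    move: xx' dd; rewrite /ball/= sub0r normrN => xx' dd.
    have := ler_norm d; lra.
  apply: le_lt_trans (ler_distD (g x) _ _) _; rewrite [`|g x' - _|]distrC; lra.
exists (d / 2); first by rewrite divr_gt0.
move=> x y Ix xy; apply: (hd (d / 2)) => //; last by rewrite divr_gt0.
by rewrite /= sub0r normrN gtr0_norm; lra.
Qed.

Variable p : nat -> R.
Hypothesis p0 : forall k, 0 <= p k.
Hypothesis p1 : (\sum_(k <oo) (p k)%:E = 1)%E.

Definition spread_dist n f : \bar R :=
  \sum_(k <oo) (norm1 (fun x => spread p n f k x - p k * f x))%:E.

(** [regrid] moves a point within its cell, so once the mesh is below a modulus of continuity the
    [k]-th term is at most [p k * e], and these bounds sum to [e]. *)
Lemma spread_dist_continuous g (e : R) : continuous g -> L1 g -> 0 < e ->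
  exists N : nat, forall n, (N <= n)%N -> (spread_dist n g <= e%:E)%E.
Proof.
move=> cg Lg e0; have [d d0 hd] := uniformly_continuous_I01 cg e0.
have [N hN] : exists N : nat, forall n, (N <= n)%N -> n.+1%:R^-1 < d.
  have [N hN] := @ltr_add_invr R 0 d d0; exists N => n Nn.
  apply: le_lt_trans hN; rewrite add0r lef_pV2 ?posrE//.
  by rewrite ler_nat.
exists N => n /hN nd.
rewrite -[leRHS]mule1 -p1 -nneseriesZl; last by move=> k _; rewrite lee_fin.
apply: lee_nneseries => [k _ _|k _]; first by rewrite lee_fin norm1_ge0.
rewrite -EFinM lee_fin mulrC.
have [pk|pk] := eqVneq (p k) 0.
  rewrite (@eq_norm1 _ _ (fun x => 0 * g x)); last first.
    by move=> x; rewrite /spread pk !mul0r subr0.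
  by rewrite norm1Z// normr0 pk !mul0r.
have pk0 : 0 < p k by rewrite lt0r pk p0.
have L : L1 (fun x => spread p n g k x - p k * g x).
  by apply: L1B; [exact: L1_spread|exact: L1Z].
rewrite -lee_fin norm1J//.
apply: (@le_trans _ _ (\int[leb]_(x in J) (cst (p k * e)%:E x))%E); last first.
  rewrite integral_cst; last exact: measurable_J.
  by rewrite /= lebesgue_measure_itv/= lte_fin ltr01 oppr0 adde0 mule1.
apply: ge0_le_integral => //.
- apply: (measurable_funS _ (@sub_J_I01 R)); first exact: measurable_I01.
  exact: measurable_int (L1_norm L).
- move=> x Jx; rewrite /= lee_fin /spread.
  have r01 := psum_offset01 p0 p1 (offset_itv n x) pk0.
  rewrite patchE mem_set; last exact: J_shift.
  rewrite -mulrBr normrM ger0_norm// ler_wpM2l// distrC ltW//.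
  apply: hd; first exact: sub_J_I01.
  have xE : x = (cell n x + offset n x) / n.+1%:R.
    by rewrite /offset addrC subrK mulrC mulrA mulVf ?mul1r// pnatr_eq0.
  rewrite {1}xE /regrid -mulrBl normrM [`|_^-1|]ger0_norm ?invr_ge0//.
  apply: le_lt_trans nd; rewrite ler_piMl ?invr_ge0//.
  have /andP[t0 t1] := offset_itv n x; move: r01 => /andP[r0 r1].
  rewrite opprD addrACA subrr add0r ler_norml; lra.
Qed.

Lemma spreadB n f g k x :
  spread p n (fun x => f x - g x) k x = spread p n f k x - spread p n g k x.
Proof.
rewrite /spread /patch; case: ifP => _; first by rewrite mulrBr.
by rewrite !mulr0 subr0.
Qed.

Lemma L1_dense_continuous f (e : R) : L1 f -> 0 < e ->
  exists g, [/\ continuous g, L1 g & norm1 (fun x => f x - g x) <= e].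
Proof.
move=> Lf e0.
have I01y : (leb I01 < +oo)%E.
  by rewrite lebesgue_measure_itv/= lte_fin ltr01 oppr0 adde0 ltry.
have [g_ [cg Lg fg]] := approximation_continuous_integrable (@measurable_I01 R) I01y Lf.
have [n _ hn] : \forall n \near \oo,
    (\int[leb]_(z in I01) `|(f z - g_ n z)%:E| < e%:E)%E.
  apply: (fg [set x | x < e%:E]%E); apply: open_nbhs_nbhs; split.
    exact: open_ereal_lt_ereal.
  by rewrite /= lte_fin.
exists (g_ n); split; [exact: cg|exact: Lg|].
rewrite -lee_fin norm1E; last exact: (L1B Lf (Lg n)).
exact: (ltW (hn n (leqnn n))).
Qed.

(** For a continuous [g] near [f], the spreads of [f - g] have total norm [norm1 (f - g)] by
    isometry, and so do the multiples [p k (f - g)]; each of the three errors gets a third of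
    [e]. *)
Lemma spread_dist_cvg f (e : R) : L1 f -> 0 < e ->
  exists N : nat, forall n, (N <= n)%N -> (spread_dist n f <= e%:E)%E.
Proof.
move=> Lf e0.
have e3 : 0 < e / 3 by rewrite divr_gt0.
have [g [cg Lg fg]] := L1_dense_continuous Lf e3.
have [N hN] := spread_dist_continuous cg Lg e3; exists N => n /hN nN.
have Lfg := L1B Lf Lg.
have Lsf k := L1_spread p0 p1 n k Lf; have Lsg k := L1_spread p0 p1 n k Lg.
have Lsfg k := L1_spread p0 p1 n k Lfg.
have term k : norm1 (fun x => spread p n f k x - p k * f x) <=
   norm1 (spread p n (fun x => f x - g x) k) +
   (norm1 (fun x => spread p n g k x - p k * g x) +
   p k * norm1 (fun x => f x - g x)).
  have Lpfg := L1Z (p k) (L1B Lg Lf).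
  have LB := L1B (Lsg k) (L1Z (p k) Lg).
  have -> : p k * norm1 (fun x => f x - g x) = norm1 (fun x => p k * (g x - f x)).
    rewrite norm1Z ?ger0_norm//; last exact: L1B.
    congr (_ * _); rewrite -norm1N; apply: eq_norm1 => x; by rewrite opprB.
  apply: le_trans; last first.
    apply: lerD; first exact: lexx.
    exact: (norm1D LB Lpfg).
  apply: le_trans (norm1D (Lsfg k) (L1D LB Lpfg)).
  rewrite le_eqVlt; apply/orP; left; apply/eqP/eq_norm1 => x.
  by rewrite spreadB; ring.
rewrite /spread_dist; apply: (@le_trans _ _ (\sum_(k <oo)
    ((norm1 (spread p n (fun x => f x - g x)%R k))%:E +
   ((norm1 (fun x => spread p n g k x - p k * g x)%R)%:E +
   (norm1 (fun x => f x - g x)%R)%:E * (p k)%:E)))%E).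
  apply: lee_nneseries => [k _ _|k _]; first by rewrite lee_fin norm1_ge0.
  by rewrite -EFinM -!EFinD lee_fin [_ * p k]mulrC term.
have ge0 (h : R -> R) : (0 <= (norm1 h)%:E)%E by rewrite lee_fin norm1_ge0.
have ge0p k : (0 <= (norm1 (fun x => f x - g x))%:E * (p k)%:E)%E.
  by rewrite mule_ge0// lee_fin.
rewrite nneseriesD//; last by move=> k _ _; rewrite adde_ge0.
rewrite nneseriesD// nneseriesZl//; last by move=> k _; rewrite lee_fin.
rewrite p1 mule1 (spread_isometry p0 p1)//.
apply: le_trans (leeD (lexx _) (leeD nN (lexx _))) _.
rewrite -!EFinD lee_fin; lra.
Qed.

End spread_approx.

(** * The conjugated action *)

Section conjugate_action.
Variables (R : realType) (G : groupType) (rho : G -> Op R).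
Hypothesis rho_action : is_action rho.
Implicit Types (f : R -> R) (g h : G).

Let rho_L1 g f : L1 f -> L1 (rho g f).
Proof. by have [/(_ g) [[+ _ _ _ _] _] _ _] := rho_action; exact. Qed.

Let rho_aeq g f f' : L1 f -> L1 f' -> aeq f f' -> aeq (rho g f) (rho g f').
Proof. by have [/(_ g) [[_ + _ _ _] _] _ _] := rho_action; exact. Qed.

Let rho_lin g (a b : R) f f' : L1 f -> L1 f' ->
  aeq (rho g (fun x => a * f x + b * f' x)) (fun x => a * rho g f x + b * rho g f' x).
Proof. by have [/(_ g) [[_ _ + _ _] _] _ _] := rho_action; exact. Qed.

Let rho_pos g f : L1 f -> ae_nonneg f -> ae_nonneg (rho g f).
Proof. by have [/(_ g) [[_ _ _ + _] _] _ _] := rho_action; exact. Qed.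

Let rho_norm g f : L1 f -> norm1 (rho g f) = norm1 f.
Proof. by have [/(_ g) [[_ _ _ _ +] _] _ _] := rho_action; exact. Qed.

Let rho1 f : L1 f -> aeq (rho 1%g f) f.
Proof. by have [_ + _] := rho_action; exact. Qed.

Let rhoM g h f : L1 f -> aeq (rho (g * h)%g f) (rho g (rho h f)).
Proof. by have [_ _ +] := rho_action; exact. Qed.

Let rhoB g f f' : L1 f -> L1 f' ->
  aeq (rho g (fun x => f x - f' x)) (fun x => rho g f x - rho g f' x).
Proof.
move=> Lf Lf'; have := rho_lin g 1 (- 1) Lf Lf'.
under eq_fun do rewrite mul1r mulN1r.
by under [X in aeq _ X]eq_fun do rewrite mul1r mulN1r.
Qed.

Let rhoZ g (a : R) f : L1 f ->
  aeq (rho g (fun x => a * f x)) (fun x => a * rho g f x).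
Proof.
move=> Lf; have := rho_lin g a 0 Lf Lf.
under eq_fun do rewrite mul0r addr0.
by under [X in aeq _ X]eq_fun do rewrite mul0r addr0.
Qed.

(* A surjective lattice isometry of [L1] onto [l1(G; L1)], given by its
   coordinates. *)
Variable D : G -> Op R.
Hypothesis D_L1 : forall h f, L1 f -> L1 (D h f).
Hypothesis D_lin : forall h (a b : R) f f',
  D h (fun x => a * f x + b * f' x) = (fun x => a * D h f x + b * D h f' x).
Hypothesis D_normr : forall h f, D h (fun x => `|f x|) = (fun x => `|D h f x|).
Hypothesis D_isometry : forall f, L1 f ->
  (\esum_(h in [set: G]) (norm1 (D h f))%:E = (norm1 f)%:E)%E.
Hypothesis D_surj : forall F : G -> R -> R, (forall h, L1 (F h)) ->
  (\esum_(h in [set: G]) (norm1 (F h))%:E < +oo)%E ->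
  exists2 f, L1 f & forall h, aeq (D h f) (F h).

Let DB h f f' : D h (fun x => f x - f' x) = (fun x => D h f x - D h f' x).
Proof.
have := D_lin h 1 (- 1) f f'.
under eq_fun do rewrite mul1r mulN1r.
by under [X in _ = X]eq_fun do rewrite mul1r mulN1r.
Qed.

Let esum_norm1_eq0 (F : G -> R -> R) :
  (\esum_(h in [set: G]) (norm1 (F h))%:E = 0)%E <-> forall h, norm1 (F h) = 0.
Proof.
split=> [F0 h|F0]; last by rewrite esum1// => h _; rewrite F0.
have ge0 h' : (0 <= (norm1 (F h'))%:E)%E by rewrite lee_fin norm1_ge0.
have := esum_ge_term h ge0; rewrite F0 lee_fin => le0.
by apply/eqP; rewrite eq_le le0 norm1_ge0.
Qed.

(** An isometry is injective, so identities for the conjugated action may be checked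
    coordinatewise. *)
Let D_aeqP f f' : L1 f -> L1 f' ->
  aeq f f' <-> forall h, aeq (D h f) (D h f').
Proof.
move=> Lf Lf'; rewrite (aeqP Lf Lf').
have iso := D_isometry (L1B Lf Lf').
have -> : (norm1 (fun x => f x - f' x) = 0) <->
    (forall h, norm1 (D h (fun x => f x - f' x)) = 0).
  rewrite -(esum_norm1_eq0 (fun h => D h (fun x => f x - f' x))) iso.
  by split=> [->//|e0]; exact: EFin_inj.
split=> h0 h; have := h0 h; rewrite DB.
  by move=> /(aeqP (D_L1 h Lf) (D_L1 h Lf')).
by move=> /(aeqP (D_L1 h Lf) (D_L1 h Lf')).
Qed.

Definition conj_target g f h := rho g (D (g^-1 * h)%g f).

(** [D] is onto only modulo [aeq], so a preimage is chosen; for [f] in L1 the default 0 is never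
    reached. *)
Definition conj_action g f : R -> R :=
  xget (fun=> 0) [set f' | L1 f' /\ forall h, aeq (D h f') (conj_target g f h)].

Let target_L1 g f h : L1 f -> L1 (conj_target g f h).
Proof. by move=> Lf; apply: rho_L1; exact: D_L1. Qed.

Let esum_target g f : L1 f ->
  (\esum_(h in [set: G]) (norm1 (conj_target g f h))%:E = (norm1 f)%:E)%E.
Proof.
move=> Lf; rewrite -D_isometry// [RHS](reindex_esum _ _ _ _ (bij_mulg g^-1%g)).
by apply: eq_esum => h _; rewrite /conj_target rho_norm//; exact: D_L1.
Qed.

Let conj_spec g f : L1 f ->
  L1 (conj_action g f) /\ forall h, aeq (D h (conj_action g f)) (conj_target g f h).
Proof.
move=> Lf; have [f' Lf' f'E] : exists2 f', L1 f' & forall h, aeq (D h f') (conj_target g f h).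
  apply: D_surj => [h|]; first exact: target_L1.
  by rewrite esum_target// ltry.
exact: (@xgetPex _ (fun=> 0) [set f' | L1 f' /\ forall h, aeq (D h f') (conj_target g f h)]
  (ex_intro _ f' (conj Lf' f'E))).
Qed.

Let conj_L1 g f : L1 f -> L1 (conj_action g f).
Proof. by move=> /(conj_spec g)[]. Qed.

Let conjE g f h : L1 f -> aeq (D h (conj_action g f)) (conj_target g f h).
Proof. by move=> /(conj_spec g)[_]; exact. Qed.

Let conj_uniq g f f' : L1 f -> L1 f' ->
  (forall h, aeq (D h f') (conj_target g f h)) -> aeq (conj_action g f) f'.
Proof.
move=> Lf Lf' f'E; apply/D_aeqP => //; first exact: conj_L1.
by move=> h; apply: aeq_trans (conjE g h Lf) _; apply: aeq_sym; exact: f'E.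
Qed.

Let target_aeq g f f' h : L1 f -> L1 f' -> aeq f f' ->
  aeq (conj_target g f h) (conj_target g f' h).
Proof.
move=> Lf Lf' ff'; apply: rho_aeq; [exact: D_L1|exact: D_L1|].
by move: ff' => /(D_aeqP Lf Lf'); exact.
Qed.

Let conj_norm g f : L1 f -> norm1 (conj_action g f) = norm1 f.
Proof.
move=> Lf; apply: EFin_inj; rewrite -D_isometry; last exact: conj_L1.
rewrite -(esum_target g Lf); apply: eq_esum => h _; congr EFin.
by apply: aeq_norm1; [apply: D_L1; exact: conj_L1|exact: target_L1|exact: conjE].
Qed.

Let conj1 f : L1 f -> aeq (conj_action 1%g f) f.
Proof.
move=> Lf; apply: conj_uniq => // h; apply: aeq_sym.
by rewrite /conj_target invg1 mul1g; apply: rho1; exact: D_L1.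
Qed.

Let conjM g g' f : L1 f ->
  aeq (conj_action (g * g')%g f) (conj_action g (conj_action g' f)).
Proof.
move=> Lf; have Lf' := conj_L1 g' Lf.
apply: conj_uniq => // [|h]; first exact: conj_L1.
apply: aeq_trans (conjE g h Lf') _; rewrite /conj_target.
apply: (aeq_trans (g := rho g (conj_target g' f (g^-1 * h)%g))).
  by apply: rho_aeq; [exact: D_L1|exact: target_L1|exact: conjE].
rewrite /conj_target invgM -mulgA; apply: aeq_sym; apply: rhoM.
exact: D_L1.
Qed.

Lemma conj_is_action : is_action conj_action.
Proof.
split; [|exact: conj1|exact: conjM] => g; split; last first.
  move=> k Lk; exists (conj_action g^-1%g k); split; first exact: conj_L1.
  apply: aeq_trans (conj1 Lk); apply: aeq_sym.
  by rewrite -(mulgV g); exact: conjM.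
split.
- by move=> f; exact: conj_L1.
- move=> f f' Lf Lf' ff'; apply: conj_uniq => // [|h]; first exact: conj_L1.
  apply: aeq_trans (conjE g h Lf') _; apply: target_aeq => //.
  exact: aeq_sym.
- move=> a b f f' Lf Lf'; apply: conj_uniq => [||h].
  + exact: L1_lin.
  + by apply: L1_lin; exact: conj_L1.
  rewrite D_lin; apply: aeq_trans (aeq_lin a b (conjE g h Lf) (conjE g h Lf')) _.
  by apply: aeq_sym; rewrite /conj_target D_lin; apply: rho_lin; exact: D_L1.
- move=> f Lf fpos; apply/ae_nonnegP.
  have Lc := conj_L1 g Lf.
  apply/D_aeqP => //; first exact: L1_norm.
  move=> h; rewrite D_normr; apply/ae_nonnegP.
  have : ae_nonneg (conj_target g f h).
    apply: rho_pos; first exact: D_L1.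
    apply/ae_nonnegP; rewrite -D_normr; move/ae_nonnegP: fpos.
    by move=> /(D_aeqP (L1_norm Lf) Lf); exact.
  by apply: filterS2 (conjE g h Lf) => x e pos Ix; rewrite e// pos.
- by move=> f; exact: conj_norm.
Qed.

Variable p : G -> R.

Definition D_dist f : \bar R :=
  \esum_(h in [set: G]) (norm1 (fun x => D h f x - p h * f x))%:E.

(** In the coordinate [h], pass from [rho g (D (g^-1 * h) f)] to [p (g^-1 * h)] times [rho g f],
    then to [p h] times [rho g f], then to [D h (rho g f)]. The first step is measured by [D_dist f]
    after reindexing, since [rho g] is isometric. *)
Lemma conj_action_dist g f : L1 f ->
  ((norm1 (fun x => conj_action g f x - rho g f x)%R)%:E <=
   D_dist f +
   (norm1 f)%:E * ell1_norm (fun h => p (g^-1 * h)%g - p h)%R +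
   D_dist (rho g f))%E.
Proof.
move=> Lf; have Lr := rho_L1 g Lf; have Lc := conj_L1 g Lf.
rewrite -D_isometry; last exact: L1B.
have ge0 (k : R -> R) : (0 <= (norm1 k)%:E)%E by rewrite lee_fin norm1_ge0.
have -> : D_dist f = (\esum_(h in [set: G])
    (norm1 (fun x => D (g^-1 * h)%g f x - p (g^-1 * h)%g * f x))%:E)%E.
  by rewrite /D_dist [LHS](reindex_esum _ _ _ _ (bij_mulg g^-1%g)).
rewrite -esumZl; [|exact: norm1_ge0|by move=> h; rewrite lee_fin].
have ge0' h : (0 <= (norm1 f)%:E * `|p (g^-1 * h)%g - p h|%:E)%E.
  by rewrite mule_ge0// lee_fin.
rewrite -!esumD//; last by move=> h _; rewrite adde_ge0.
apply: le_esum => h _; rewrite -EFinM -!EFinD lee_fin DB.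
have Ld := D_L1 (g^-1 * h)%g Lf; set k := (g^-1 * h)%g in Ld *.
have Lk := L1Z (p k) Lf.
have L1' := L1Z (p k) Lr; have L2' := L1Z (p h) Lr.
have L3' := D_L1 h Lr; have L4' := D_L1 h Lc.
apply: le_trans (norm1_dist L4' L1' L3') _; rewrite -addrA; apply: lerD.
  rewrite -(rho_norm g (L1B Ld Lk)) le_eqVlt; apply/orP; left; apply/eqP.
  apply: aeq_norm1; [exact: L1B|by apply: rho_L1; exact: L1B|].
  apply: aeq_trans (aeq_sym (rhoB g Ld Lk)).
  by apply: aeqB; [exact: conjE|apply: aeq_sym; exact: rhoZ].
apply: le_trans (norm1_dist L1' L2' L3') _; apply: lerD.
  rewrite -(rho_norm g Lf) mulrC -(norm1Z _ Lr) le_eqVlt; apply/orP; left; apply/eqP.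
  by apply: eq_norm1 => x; rewrite mulrBl.
rewrite -norm1N le_eqVlt; apply/orP; left; apply/eqP/eq_norm1 => x.
by rewrite opprB.
Qed.

(** Coordinates in which the conjugated action is translation of the index. *)
Let untwist h f := rho h^-1%g (D h f).

Let untwist_L1 h f : L1 f -> L1 (untwist h f).
Proof. by move=> Lf; apply: rho_L1; exact: D_L1. Qed.

Let untwist_norm h f : L1 f -> norm1 (untwist h f) = norm1 (D h f).
Proof. by move=> Lf; apply: rho_norm; exact: D_L1. Qed.

Let untwist_aeq h f f' : L1 f -> L1 f' -> aeq f f' ->
  aeq (untwist h f) (untwist h f').
Proof.
move=> Lf Lf' ff'; apply: rho_aeq; [exact: D_L1|exact: D_L1|].
by move: ff' => /(D_aeqP Lf Lf'); exact.
Qed.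

Let untwist_lin h (a b : R) f f' : L1 f -> L1 f' ->
  aeq (untwist h (fun x => a * f x + b * f' x))
    (fun x => a * untwist h f x + b * untwist h f' x).
Proof. by move=> Lf Lf'; rewrite /untwist D_lin; apply: rho_lin; exact: D_L1. Qed.

Definition conj_sqnorm f : R :=
  fine (\esum_(h in [set: G]) sqprim (untwist h f))%E.

(** In each squared coordinate norm one factor is bounded by [norm1 f]; the other factors sum to
    [norm1 f]. *)
Let esum_sqprim_le f : L1 f ->
  (\esum_(h in [set: G]) sqprim (untwist h f) <= (norm1 f ^+ 2)%:E)%E.
Proof.
move=> Lf; rewrite expr2 EFinM -{2}D_isometry// -esumZl ?norm1_ge0//; last first.
  by move=> h; rewrite lee_fin norm1_ge0.
apply: le_esum => h _; apply: le_trans (sqprim_le (untwist_L1 h Lf)) _.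
rewrite untwist_norm// -EFinM lee_fin expr2 ler_wpM2r ?norm1_ge0//.
have ge0 h' : (0 <= (norm1 (D h' f))%:E)%E by rewrite lee_fin norm1_ge0.
by rewrite -lee_fin -(D_isometry Lf); exact: (esum_ge_term h ge0).
Qed.

Let sqnormE f : L1 f ->
  ((conj_sqnorm f)%:E = \esum_(h in [set: G]) sqprim (untwist h f))%E.
Proof.
move=> Lf; rewrite /conj_sqnorm fineK// ge0_fin_numE.
  exact: le_lt_trans (esum_sqprim_le Lf) (ltry _).
by apply: esum_ge0 => h _; exact: sqprim_ge0.
Qed.

Let sqnorm_aeq f f' : L1 f -> L1 f' -> aeq f f' -> conj_sqnorm f = conj_sqnorm f'.
Proof.
move=> Lf Lf' ff'; congr fine; apply: eq_esum => h _.
by apply: sqprim_aeq; [exact: untwist_L1|exact: untwist_L1|exact: untwist_aeq].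
Qed.

Let sqnorm_bound f : L1 f -> 0 <= conj_sqnorm f <= norm1 f ^+ 2.
Proof.
move=> Lf; rewrite -!lee_fin sqnormE// esum_sqprim_le// andbT.
by apply: esum_ge0 => h _; exact: sqprim_ge0.
Qed.

Let sqnorm_quad (a b : R) f f' : 0 <= a -> 0 <= b -> L1 f -> L1 f' ->
  conj_sqnorm (fun x => a * f x + b * f' x) +
    a * b * conj_sqnorm (fun x => f x - f' x) =
  a * (a + b) * conj_sqnorm f + b * (a + b) * conj_sqnorm f'.
Proof.
move=> a0 b0 Lf Lf'; apply: EFin_inj; rewrite !EFinD !(EFinM _ (conj_sqnorm _)).
have Ll := L1_lin a b Lf Lf'; have Lb := L1B Lf Lf'.
have ab0 := mulr_ge0 a0 b0; have aab0 := mulr_ge0 a0 (addr_ge0 a0 b0).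
have bab0 := mulr_ge0 b0 (addr_ge0 a0 b0).
have ge0 := @sqprim_ge0 R.
have ge0' (c : R) k : 0 <= c -> (0 <= c%:E * sqprim k)%E.
  by move=> c0; rewrite mule_ge0// lee_fin.
rewrite !sqnormE// -!esumZl// -!esumD//; do ?by move=> h _; exact: ge0'.
apply: eq_esum => h _.
have Lu := untwist_L1 h Lf; have Lu' := untwist_L1 h Lf'.
rewrite -sqprim_quad//; congr (_ + _ * _)%E; apply: sqprim_aeq.
- exact: untwist_L1.
- exact: L1_lin.
- exact: untwist_lin.
- exact: untwist_L1.
- exact: L1B.
- by rewrite /untwist DB; apply: rhoB; exact: D_L1.
Qed.

Let sqnormZ (a : R) f : L1 f -> conj_sqnorm (fun x => a * f x) = a ^+ 2 * conj_sqnorm f.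
Proof.
move=> Lf; apply: EFin_inj; rewrite EFinM !sqnormE//; last exact: L1Z.
rewrite -esumZl ?sqr_ge0//; last by move=> h; exact: sqprim_ge0.
apply: eq_esum => h _; have Lu := untwist_L1 h Lf.
rewrite -sqprimZ//; apply: sqprim_aeq; [|exact: L1Z|].
  by apply: untwist_L1; exact: L1Z.
have DZ : D h (fun x => a * f x) = (fun x => a * D h f x).
  have := D_lin h a 0 f f; under eq_fun do rewrite mul0r addr0.
  by under [X in _ = X]eq_fun do rewrite mul0r addr0.
by rewrite /untwist DZ; apply: rhoZ; exact: D_L1.
Qed.

Let sqnorm_eq0 f : L1 f -> conj_sqnorm f = 0 -> aeq f (fun=> 0).
Proof.
move=> Lf f0; apply/norm1_eq0 => //; apply: EFin_inj.
rewrite -D_isometry//; apply/(esum_norm1_eq0 (fun h => D h f)) => h.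
rewrite -untwist_norm//; apply/norm1_eq0; first exact: untwist_L1.
apply: sqprim_eq0; first exact: untwist_L1.
have := esum_ge_term h (fun h => sqprim_ge0 (untwist h f)).
rewrite -sqnormE// f0 => le0.
by apply/eqP; rewrite eq_le le0 sqprim_ge0.
Qed.

(** Since [h^-1 g = (g^-1 h)^-1], the [h]-th untwisted coordinate of the image is the one of [f] at
    [g^-1 h]: the terms are permuted. *)
Let sqnorm_conj g f : L1 f -> conj_sqnorm (conj_action g f) = conj_sqnorm f.
Proof.
move=> Lf; congr fine.
rewrite [RHS](reindex_esum _ _ _ _ (bij_mulg g^-1%g)); apply: eq_esum => h _.
have Lc := conj_L1 g Lf; have Lt := target_L1 g h Lf.
apply: sqprim_aeq; [exact: untwist_L1|exact: untwist_L1|].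
apply: (aeq_trans (g := rho h^-1%g (conj_target g f h))).
  by apply: rho_aeq => //; [exact: D_L1|exact: conjE].
rewrite /untwist invgM invgK; apply: aeq_sym; apply: rhoM; exact: D_L1.
Qed.

Lemma conj_action_admits_inv_sc_norm : admits_inv_sc_norm conj_action.
Proof.
exists (renorm conj_sqnorm); split.
- exact: renorm_equiv_norm.
- by move=> g f Lf; rewrite /renorm conj_norm// sqnorm_conj.
- exact: renorm_strictly_convex.
Qed.

End conjugate_action.

(** * Positive almost invariant probabilities and numbering of the group *)

Section positive_reiter.
Variables (R : realType) (G : groupType) (e : G -> nat).
Hypothesis e_inj : injective e.

Lemma positive_prob_fun : exists2 r : G -> R, prob_fun r & forall h, 0 < r h.
Proof.
pose r0 (h : G) : R := dyad R (e h).
have r0_gt0 h : 0 < r0 h by exact: dyad_gt0.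
have le1 : (\esum_(h in [set: G]) (r0 h)%:E <= 1)%E by exact: esum_dyad_le1.
have ge0 h : (0 <= (r0 h)%:E)%E by rewrite lee_fin ltW.
have gt0 : (0 < \esum_(h in [set: G]) (r0 h)%:E)%E.
  apply: lt_le_trans (esum_ge_term 1%g ge0).
  by rewrite lte_fin.
have fin : \esum_(h in [set: G]) (r0 h)%:E \is a fin_num.
  by rewrite ge0_fin_numE ?(ltW gt0)//; apply: le_lt_trans le1 (ltry _).
set S := \esum_(h in [set: G]) (r0 h)%:E in gt0 fin.
have S0 : 0 < fine S by rewrite fine_gt0// gt0 -ge0_fin_numE ?(ltW gt0).
exists (fun h => (fine S)^-1 * r0 h); last first.
  by move=> h; rewrite mulr_gt0 ?invr_gt0.
split=> [h|]; first by rewrite mulr_ge0 ?invr_ge0 ?(ltW S0)// ltW.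
under eq_esum do rewrite EFinM.
rewrite esumZl ?invr_ge0 ?(ltW S0)// -/S -[X in (_ * X)%E](fineK fin).
by rewrite -EFinM mulVf// gt_eqF.
Qed.

Lemma ell1_norm_prob_shift (p : G -> R) g : prob_fun p ->
  (ell1_norm (fun h => p (g^-1 * h)%g - p h)%R <= 2%:E)%E.
Proof.
move=> [p0 p1].
have np : ell1_norm p = 1%E.
  by rewrite -p1; apply: eq_esum => h _; rewrite ger0_norm.
apply: le_trans (ell1_normD (fun h => p (g^-1 * h)%g) (- p)) _.
rewrite ell1_norm_shift.
have -> : ell1_norm (- p) = ell1_norm p by apply: eq_esum => h _; rewrite normrN.
by rewrite np -EFinD.
Qed.

Lemma amenable_reiter_gt0 (s : seq G) (d : R) : amenable R G -> 0 < d ->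
  exists p : G -> R, [/\ prob_fun p, forall h, 0 < p h & forall g, g \in s ->
    (ell1_norm (fun h => p (g^-1 * h)%g - p h)%R <= d%:E)%E].
Proof.
move=> amG d0.
have d2 : 0 < d / 2 by rewrite divr_gt0.
have [q [q0 q1] qd] := amenable_reiter s amG d2.
have [r pr r0] := positive_prob_fun; have [_ r1] := pr.
(* Every probability has defect at most 2, so mixing in [r] with weight [a] costs at most [2 a];
   this [a] is below 1 and satisfies [2 a <= d / 2]. *)
pose a := d / (4 + d).
have d4 : 0 < 4 + d by lra.
have a0 : 0 < a by rewrite divr_gt0.
have a1 : a < 1 by rewrite ltr_pdivrMr// mul1r; lra.
have a2 : a * 2 <= d / 2.
  rewrite /a -mulrA ler_wpM2l ?(ltW d0)// mulrC ler_pdivrMr//.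
  by lra.
pose p := (1 - a) *: q + a *: (r : G -> R).
have b0 : 0 <= 1 - a by lra.
have pE h : p h = (1 - a) * q h + a * r h by [].
exists p; split.
- split=> [h|]; first by rewrite pE addr_ge0// mulr_ge0// ltW.
  under eq_esum do rewrite pE EFinD EFinM (EFinM a).
  rewrite esumD; last 2 first.
  + by move=> h _; rewrite mule_ge0 ?lee_fin.
  + by move=> h _; rewrite mule_ge0 ?lee_fin// ltW.
  rewrite !esumZl ?(ltW a0)//; last by move=> h; rewrite lee_fin ltW.
  by rewrite q1 r1 !mule1 -EFinD subrK.
- by move=> h; rewrite pE ltr_wpDl// ?mulr_ge0// mulr_gt0.
move=> g gs.
have -> : (fun h => p (g^-1 * h)%g - p h) =
    (1 - a) *: (fun h => q (g^-1 * h)%g - q h) +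
    a *: (fun h => r (g^-1 * h)%g - r h).
  by apply/funext => h; rewrite !fctE !pE /GRing.scale/=; ring.
apply: le_trans (ell1_normD _ _) _; rewrite !ell1_normZ.
apply: (@le_trans _ _ ((d / 2)%:E + (d / 2)%:E)%E); last first.
  by rewrite -EFinD lee_fin; lra.
apply: leeD.
  rewrite ger0_norm//; apply: le_trans (_ : (1 * (d / 2)%:E <= _)%E); last by rewrite mul1e.
  by apply: lee_pmul; rewrite ?lee_fin ?ell1_norm_ge0//; [lra|exact: qd].
rewrite ger0_norm ?(ltW a0)//; apply: (@le_trans _ _ (a%:E * 2%:E)%E); last first.
  by rewrite -EFinM lee_fin.
by rewrite lee_wpmul2l ?lee_fin ?(ltW a0)//; exact: ell1_norm_prob_shift.
Qed.

(** Numbers outside the range of [e] get [z]; for [p] this means empty pieces, so finite and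
    infinite groups are treated alike. *)
Definition on_nat (T : Type) (z : T) (F : G -> T) (k : nat) : T :=
  if pselect (exists h, e h = k) is left ex then F (sval (cid ex)) else z.

Lemma on_natE (T : Type) (z : T) (F : G -> T) h : on_nat z F (e h) = F h.
Proof.
rewrite /on_nat; case: pselect => [ex|[]]; last by exists h.
by congr F; apply: e_inj; case: cid.
Qed.

Lemma on_nat_default (T : Type) (z : T) (F : G -> T) k :
  (forall h, e h <> k) -> on_nat z F k = z.
Proof. by rewrite /on_nat => ek; case: pselect => // ex; have [h /ek] := ex. Qed.

Lemma nneseries_enum (u : nat -> \bar R) : (forall k, 0 <= u k)%E ->
  (forall k, (forall h, e h <> k) -> u k = 0)%E ->
  (\sum_(k <oo) u k = \esum_(h in [set: G]) u (e h))%E.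
Proof.
move=> u0 uz; rewrite -(esum_image setT e) => [|x y _ _]; last exact: e_inj.
rewrite nneseries_esumT// [RHS]esum_mkcond; apply: eq_esum => k _.
case: ifPn => // kN; apply: uz => h hk; move/negP: kN; apply.
by rewrite inE; exists h.
Qed.

End positive_reiter.

Unset Implicit Arguments.

(* Density in Act^+_G(L_1[0,1]) (product of strong operator topologies),
   unfolded via basic neighbourhoods: for every action rho, every finite
   set S of group elements, every finite set Phi of elements of L_1[0,1]
   and every eps > 0 there is an action rho' admitting an equivalent
   G-invariant strictly convex norm with ||rho' g f - rho g f||_1 < eps
   for all g in S and f in Phi. *)
Theorem theorem5p5 (R : realType) (G : groupType) :
  countable_group G -> amenable R G ->
  forall rho : G -> Op R, is_action rho ->
  forall (S : set G) (Phi : set (R -> R)),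
    finite_set S -> finite_set Phi -> (forall f, Phi f -> L1 f) ->
  forall eps : R, 0 < eps ->
  exists rho' : G -> Op R,
    [/\ is_action rho', admits_inv_sc_norm rho' &
        forall g f, S g -> Phi f ->
          norm1 (fun x => rho' g f x - rho g f x) < eps].
Proof.
move=> [e e_inj] amG rho rho_act S Phi finS finPhi PhiL1 eps eps0.
have rho_L1 g f : L1 f -> L1 (rho g f).
  by have [/(_ g) [[+ _ _ _ _] _] _ _] := rho_act; exact.
have [s sE] : exists s : seq G, forall g, S g -> g \in s.
  by have /finite_seqP[s ->] := finS; exists s.
have [sPhi sPhiE] : exists sPhi : seq (R -> R), forall f, Phi f <-> f \in sPhi.
  by have /finite_seqP[t ->] := finPhi; exists t.
(* The summand 1 keeps [M] positive when all norms vanish. *)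
pose M := 1 + \sum_(f <- sPhi) norm1 f.
have M0 : 0 < M by rewrite ltr_pwDl// sumr_ge0// => f _; exact: norm1_ge0.
have PhiM f : Phi f -> norm1 f <= M.
  move=> /sPhiE fs; rewrite /M (big_rem f)//= addrCA lerDl addr_ge0//.
  by apply: sumr_ge0 => f' _; exact: norm1_ge0.
(* With this defect each of the three errors in [conj_action_dist] is at most [eps / 4], and their
   sum stays strictly below [eps]. *)
have d0 : 0 < eps / (4 * M) by rewrite divr_gt0// mulr_gt0.
have [p [[p0 p1] p_gt0 pS]] := amenable_reiter_gt0 e_inj s amG d0.
pose P := on_nat e 0 p.
have PE h : P (e h) = p h by exact: on_natE.
have P0 k : 0 <= P k.
  by rewrite /P /on_nat; case: pselect => // ex; exact: ltW.
have P1 : (\sum_(k <oo) (P k)%:E = 1)%E.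
  rewrite (nneseries_enum e_inj) => [|k|k ek]; last 2 first.
  - by rewrite lee_fin.
  - by rewrite /P on_nat_default.
  by under eq_esum do rewrite PE.
have eps4 : 0 < eps / 4 by rewrite divr_gt0.
(* One grid must serve every [f] together with every [rho g f], as both enter the error. *)
have [n hn] : exists n, forall f, f \in sPhi ++ [seq rho g f | g <- s, f <- sPhi] ->
    (spread_dist P n f <= (eps / 4)%:E)%E.
  have : forall f, f \in sPhi ++ [seq rho g f | g <- s, f <- sPhi] -> L1 f.
    move=> f; rewrite mem_cat => /orP[/sPhiE/PhiL1//|/allpairsP[[g f'] /= [_ f's ->]]].
    by apply: rho_L1; apply: PhiL1; exact/sPhiE.
  suff : forall t : seq (R -> R), (forall f, f \in t -> L1 f) ->
    exists N : nat, forall n f, (N <= n)%N -> f \in t ->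
      (spread_dist P n f <= (eps / 4)%:E)%E.
    by move=> /[apply] -[N hN]; exists N => f; exact: hN.
  elim=> [_|f t ih Lt]; first by exists 0%N.
  have [N1 h1] := ih (fun f' h => Lt f' (mem_behead (s := f :: t) h)).
  have [N2 h2] := spread_dist_cvg P0 P1 (Lt f (mem_head _ _)) eps4.
  exists (maxn N1 N2) => n f'; rewrite geq_max => /andP[n1 n2].
  by rewrite inE => /orP[/eqP->|f't]; [exact: h2|exact: h1].
pose D (h : G) : Op R := fun f => spread P n f (e h).
have D_L1 h f : L1 f -> L1 (D h f) by move=> Lf; exact: L1_spread.
have Pz k f : (forall h, e h <> k) -> spread P n f k = fun=> 0.
  by move=> ek; apply/funext => x; rewrite /spread /P on_nat_default// mul0r.
have norm10 : norm1 (fun=> 0 : R) = 0 by exact/norm1_eq0/aeq_refl/L1_cst.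
have D_iso f : L1 f ->
    (\esum_(h in [set: G]) (norm1 (D h f))%:E = (norm1 f)%:E)%E.
  move=> Lf; rewrite -(spread_isometry P0 P1 n Lf) (nneseries_enum e_inj)//.
    by move=> k; rewrite lee_fin norm1_ge0.
  by move=> k ek; rewrite Pz// norm10.
have D_surj (F : G -> R -> R) : (forall h, L1 (F h)) ->
    (\esum_(h in [set: G]) (norm1 (F h))%:E < +oo)%E ->
    exists2 f, L1 f & forall h, aeq (D h f) (F h).
  move=> LF Fy; pose F' := on_nat e (fun=> 0 : R) F.
  have LF' k : L1 (F' k).
    by rewrite /F' /on_nat; case: pselect => // _; exact: L1_cst.
  have [|f Lf fE] := spread_surj P0 P1 n (F := F') LF'.
    rewrite (nneseries_enum e_inj) => [|k|k ek].
    - by under eq_esum do rewrite /F' on_natE//.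
    - by rewrite lee_fin norm1_ge0.
    - by rewrite /F' on_nat_default// norm10.
  exists f => // h; have := fE (e h); rewrite PE /F' on_natE//; apply.
  exact: p_gt0.
have D_distE f : D_dist D p f = spread_dist P n f.
  rewrite /D_dist /spread_dist (nneseries_enum e_inj) => [|k|k ek].
  - by apply: eq_esum => h _; rewrite PE.
  - by rewrite lee_fin norm1_ge0.
  rewrite (@eq_norm1 _ _ (fun=> 0)) ?norm10// => x.
  by rewrite Pz// /P on_nat_default// mul0r subr0.
have D_lin h (a b : R) f f' :
    D h (fun x => a * f x + b * f' x) = (fun x => a * D h f x + b * D h f' x).
  exact: spread_lin.
have D_normr h f : D h (fun x => `|f x|) = (fun x => `|D h f x|).
  exact: spread_normr.
exists (conj_action rho D); split.
- exact: conj_is_action.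
- exact: conj_action_admits_inv_sc_norm.
move=> g f Sg Phif; have Lf := PhiL1 _ Phif.
rewrite -lte_fin.
apply: le_lt_trans (conj_action_dist rho_act D_L1 D_lin D_iso D_surj p g Lf) _.
rewrite !D_distE.
have fs : f \in sPhi by exact/sPhiE.
have h1 : (spread_dist P n f <= (eps / 4)%:E)%E by apply: hn; rewrite mem_cat fs.
have h2 : (spread_dist P n (rho g f) <= (eps / 4)%:E)%E.
  by apply: hn; rewrite mem_cat allpairs_f ?orbT// sE.
have h3 : ((norm1 f)%:E * ell1_norm (fun h => p (g^-1 * h)%g - p h)%R <= (eps / 4)%:E)%E.
  apply: (@le_trans _ _ (M%:E * (eps / (4 * M))%:E)%E).
    by apply: lee_pmul; rewrite ?lee_fin ?norm1_ge0 ?ell1_norm_ge0 ?PhiM ?pS ?sE.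
  rewrite -EFinM lee_fin le_eqVlt; apply/orP; left; apply/eqP.
  by field; rewrite gt_eqF.
apply: le_lt_trans (leeD (leeD h1 h3) h2) _.
by rewrite -!EFinD lte_fin; lra.
Qed.
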